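(* Suppose every component $f_i:\mathbb{R}^d\to\mathbb{R}$ ($i=1,\dots,n$, $n\ge 2$) is differentiable with $L$-Lipschitz gradient (components need not be convex), the average $F=\frac1n\sum_{i=1}^n f_i$ is $\mu$-strongly convex with $0<\mu\le L$ and unique minimizer $x_\star$, and, for some $\nu\in(0,1]$ and $\rho_\nu\ge0$, $F$ is twice differentiable with $\|\nabla^2F(u)-\nabla^2F(v)\|_{\mathrm{op}}\le\rho_\nu\|u-v\|^\nu$ for all $u,v\in\mathbb{R}^d$. Suppose random reshuffling is run with constant component stepsize $\eta>0$ satisfying $n\eta\le\frac{\mu}{32L^2}$. Then, for every $K\ge1$, with $T=nK$ and $c_\nu=\frac{2^{-(1+\nu)}}{1+\nu}$, $$ \mathbb{E}\|y_K-x_\star\|^2\le\exp\left(-\frac{\mu\eta T}{2}\right)D^2+\frac{64L^2G^2}{\mu^2}\eta^2+\frac{6L^2G^2}{\mu}n^2\eta^3+\frac{32c_\nu^2\rho_\nu^2G^{2+2\nu}}{\mu^2}n^{1+\nu}\eta^{2+2\nu}. $$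
   Context: Random reshuffling (RR) with constant component stepsize $\eta>0$ starts from a deterministic point $y_0\in\mathbb{R}^d$. At each epoch $k=0,1,\dots,K-1$ it draws a fresh, independent, uniformly random permutation $\pi_k$ of $\{1,\dots,n\}$, sets $x_{k,0}=y_k$, performs $x_{k,i}=x_{k,i-1}-\eta\nabla f_{\pi_k(i)}(x_{k,i-1})$ for $i=1,\dots,n$, and sets $y_{k+1}=x_{k,n}$. Expectations are over the permutations. Constants: $G_\star:=\max_{i}\|\nabla f_i(x_\star)\|$, $D:=\max\{\|y_0-x_\star\|,\,G_\star/(2L)\}$, $G:=G_\star+2LD$. *)

(* Defs.v *)
From mathcomp Require Export all_boot all_order all_algebra all_fingroup.
From mathcomp Require Export all_classical all_reals all_analysis.

Set Implicit Arguments.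
Unset Strict Implicit.
Unset Printing Implicit Defensive.

Import Order.TTheory GRing.Theory Num.Theory.
Import numFieldNormedType.Exports.

Local Open Scope classical_set_scope.
Local Open Scope ring_scope.

(* The norm [`|x|] that the library puts on matrices is the sup norm. Only
   Euclidean norms are used below; [differentiable] and [jacobian] depend on the
   topology alone, so they are insensitive to the choice of norm. *)
Definition enorm (R : realType) (d : nat) (x : 'rV[R]_d) : R :=
  Num.sqrt (\sum_(j < d) x 0 j ^+ 2).

Definition opnorm (R : realType) (d : nat) (A : 'M[R]_d) : R :=
  sup [set enorm (v *m A) | v in [set v : 'rV[R]_d | enorm v <= 1]].

Definition gradient (R : realType) (d : nat) (f : 'rV[R]_d -> R)
    (x : 'rV[R]_d) : 'rV[R]_d :=
  \row_(j < d) ('D_(delta_mx 0 j) f x : R).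

(* With row vectors, [jacobian g x i j] is the i-th partial derivative of the
   j-th coordinate of [g], so the (i, j) entry here is d_i d_j f. *)
Definition hessian (R : realType) (d : nat) (f : 'rV[R]_d -> R)
    (x : 'rV[R]_d) : 'M[R]_d :=
  jacobian (gradient f) x.

Definition twice_differentiable (R : realType) (d : nat)
    (f : 'rV[R]_d -> R) : Prop :=
  (forall x : 'rV[R]_d, differentiable f x) /\
  (forall x : 'rV[R]_d, differentiable (gradient f) x).

Definition lipschitz_gradient (R : realType) (d : nat) (L : R)
    (f : 'rV[R]_d -> R) : Prop :=
  forall x y, enorm (gradient f x - gradient f y) <= L * enorm (x - y).

Definition holder_hessian (R : realType) (d : nat) (nu rho : R)
    (f : 'rV[R]_d -> R) : Prop :=
  forall u v, opnorm (hessian f u - hessian f v) <= rho * enorm (u - v) `^ nu.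

Definition strongly_convex (R : realType) (d : nat) (mu : R)
    (f : 'rV[R]_d -> R) : Prop :=
  forall (x y : 'rV[R]_d) (t : R), 0 <= t <= 1 ->
    f (t *: x + (1 - t) *: y)
      <= t * f x + (1 - t) * f y - mu / 2 * (t * (1 - t)) * enorm (x - y) ^+ 2.

Definition minimizer (R : realType) (d : nat) (f : 'rV[R]_d -> R)
    (x : 'rV[R]_d) : Prop :=
  forall y, f x <= f y.

Definition average (R : realType) (d n : nat) (f : 'I_n -> 'rV[R]_d -> R)
    (x : 'rV[R]_d) : R :=
  n%:R^-1 * \sum_(i < n) f i x.

Definition rr_epoch (R : realType) (d n : nat) (f : 'I_n -> 'rV[R]_d -> R)
    (eta : R) (s : 'S_n) (y : 'rV[R]_d) : 'rV[R]_d :=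
  foldl (fun x (i : 'I_n) => x - eta *: gradient (f (s i)) x) y (enum 'I_n).

Fixpoint rr_iterate (R : realType) (d n : nat) (f : 'I_n -> 'rV[R]_d -> R)
    (eta : R) (y0 : 'rV[R]_d) (s : nat -> 'S_n) (k : nat) : 'rV[R]_d :=
  if k is k'.+1 then rr_epoch f eta (s k') (rr_iterate f eta y0 s k') else y0.

(* Random elements of a finite type A carrying the discrete sigma-algebra. *)
Definition measurable_element (disp : measure_display)
    (Omega : measurableType disp) (A : finType) (X : Omega -> A) : Prop :=
  forall B : set A, measurable (X @^-1` B).

Definition uniformly_distributed (R : realType) (disp : measure_display)
    (Omega : measurableType disp) (P : probability Omega R) (A : finType)
    (X : Omega -> A) : Prop :=
  forall a : A, P (X @^-1` [set a]) = (#|A|%:R^-1)%:E.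

Definition mutually_independent (R : realType) (disp : measure_display)
    (Omega : measurableType disp) (P : probability Omega R) (I A : finType)
    (X : I -> Omega -> A) : Prop :=
  forall (J : {set I}) (B : I -> set A),
    P (\bigcap_(i in [set` J]) (X i @^-1` B i))
      = (\prod_(i in J) P (X i @^-1` B i))%E.

(* Main.v *)
(* One epoch is compared with the mean trajectory m_i = E x_i. The second moment
   of x_n splits into |m_n - x_*|^2 and the variance of x_n, both computed over
   the permutation of that epoch.

   The mean obeys m_(i+1) = m_i - eta grad F(m_i) up to two biases. Swapping two
   entries of the permutation moves the iterate by at most about 2 eta G
   (algorithmic stability), so E grad f_(pi(i))(x_i) differs from E grad F(x_i)
   by O(L eta G). Expanding grad F at m_i, where the linear term averages out,
   E grad F(x_i) differs from grad F(m_i) by a multiple of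
   Var(x_i)^((1 + nu) / 2), by Jensen. Strong convexity contracts the rest.

   For the variances, replacing x_j by m_j inside the gradients leaves a linear
   permutation statistic sum_j a_j(pi(j)), whose variance is at most
   (n - 1)^-1 sum_(j,k) |a_j(k)|^2. This gives Var(x_i) of order n eta^2 G^2
   for i < n. For i = n the sum of the gradients at the starting point is
   deterministic and drops out, which leaves order L^2 G^2 n^3 eta^4. *)
Require Import Defs.
From mathcomp Require Import ring lra measurable_realfun.

Set Implicit Arguments.
Unset Strict Implicit.
Unset Printing Implicit Defensive.

Import Order.TTheory GRing.Theory Num.Theory.
Import numFieldNormedType.Exports.

Local Open Scope classical_set_scope.
Local Open Scope ring_scope.

(** * Euclidean space and finite averages *)

Section EuclideanSpace.
Variables (R : realType) (d : nat).
Implicit Types (u v w : 'rV[R]_d) (a t : R).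

Definition dot u v : R := \sum_(j < d) u 0 j * v 0 j.

Lemma dotC u v : dot u v = dot v u.
Proof. by apply: eq_bigr => j _; rewrite mulrC. Qed.

Lemma dotDl u v w : dot (u + v) w = dot u w + dot v w.
Proof. by rewrite -big_split; apply: eq_bigr => j _; rewrite mxE mulrDl. Qed.

Lemma dotZl a u v : dot (a *: u) v = a * dot u v.
Proof. by rewrite /dot mulr_sumr; apply: eq_bigr => j _; rewrite mxE mulrA. Qed.

Lemma dotNl u v : dot (- u) v = - dot u v.
Proof. by rewrite -scaleN1r dotZl mulN1r. Qed.

Lemma dotBl u v w : dot (u - v) w = dot u w - dot v w.
Proof. by rewrite dotDl dotNl. Qed.

Lemma dot0l u : dot 0 u = 0.
Proof. by rewrite -(scale0r 0) dotZl mul0r. Qed.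

Lemma dot_suml (I : finType) (P : pred I) (u : I -> 'rV[R]_d) v :
  dot (\sum_(i | P i) u i) v = \sum_(i | P i) dot (u i) v.
Proof. by elim/big_rec2: _ => [|i x y _ <-]; rewrite ?dot0l ?dotDl. Qed.

Lemma dotDr u v w : dot w (u + v) = dot w u + dot w v.
Proof. by rewrite !(dotC w) dotDl. Qed.

Lemma dotZr a u v : dot v (a *: u) = a * dot v u.
Proof. by rewrite !(dotC v) dotZl. Qed.

Lemma dotNr u v : dot v (- u) = - dot v u.
Proof. by rewrite !(dotC v) dotNl. Qed.

Lemma dotBr u v w : dot w (u - v) = dot w u - dot w v.
Proof. by rewrite dotDr dotNr. Qed.

Lemma dot_sumr (I : finType) (P : pred I) (u : I -> 'rV[R]_d) v :
  dot v (\sum_(i | P i) u i) = \sum_(i | P i) dot v (u i).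
Proof. by rewrite dotC dot_suml; apply: eq_bigr => i _; rewrite dotC. Qed.

Lemma dot_ge0 u : 0 <= dot u u.
Proof. by apply: sumr_ge0 => j _; rewrite -expr2 sqr_ge0. Qed.

Lemma sqr_enorm u : enorm u ^+ 2 = dot u u.
Proof.
rewrite /enorm sqr_sqrtr; last by apply: sumr_ge0 => j _; rewrite sqr_ge0.
by apply: eq_bigr => j _; rewrite expr2.
Qed.

Lemma enorm_ge0 u : 0 <= enorm u.
Proof. exact: sqrtr_ge0. Qed.

Lemma enorm_le u a : 0 <= a -> dot u u <= a ^+ 2 -> enorm u <= a.
Proof. by move=> a0 ua; rewrite -(@ler_pXn2r _ 2) ?nnegrE ?enorm_ge0// sqr_enorm. Qed.

Lemma enormZ a u : enorm (a *: u) = `|a| * enorm u.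
Proof.
apply/eqP; rewrite -(@eqrXn2 _ 2)// ?mulr_ge0 ?enorm_ge0//.
by rewrite exprMn !sqr_enorm dotZl dotZr mulrA real_normK ?num_real ?expr2.
Qed.

Lemma enormN u : enorm (- u) = enorm u.
Proof. by rewrite -scaleN1r enormZ normrN1 mul1r. Qed.

Lemma enorm0 : enorm (0 : 'rV[R]_d) = 0.
Proof. by rewrite -(scale0r 0) enormZ normr0 mul0r. Qed.

Lemma enorm_eq0 u : enorm u = 0 -> u = 0.
Proof.
move=> u0; have : dot u u = 0 by rewrite -sqr_enorm u0 expr0n.
move/eqP; rewrite psumr_eq0 => [/allP uj0|j _]; last by rewrite -expr2 sqr_ge0.
apply/rowP => j; rewrite mxE; apply/eqP.
by have := uj0 j (mem_index_enum j); rewrite -expr2 sqrf_eq0.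
Qed.

(** Cauchy-Schwarz, from the nonnegative square of [enorm v ^+ 2 *: u - dot u v *: v], a multiple of
    the part of [u] orthogonal to [v]. *)
Lemma dot_le_enorm u v : dot u v <= enorm u * enorm v.
Proof.
have [v0|vN0] := eqVneq (enorm v) 0.
  by rewrite v0 (enorm_eq0 v0) dotC dot0l mulr0.
have v_gt0 : 0 < enorm v by rewrite lt_def vN0 enorm_ge0.
have := dot_ge0 (enorm v ^+ 2 *: u - dot u v *: v).
rewrite !(dotBl, dotBr, dotZl, dotZr) (dotC v u) -!sqr_enorm => h.
rewrite (le_trans (ler_norm _))// -(@ler_pXn2r _ 2)// ?nnegrE ?mulr_ge0 ?enorm_ge0//.
rewrite real_normK ?num_real// -(ler_pM2l (exprn_gt0 2 v_gt0)); nra.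
Qed.

Lemma enormD u v : enorm (u + v) <= enorm u + enorm v.
Proof.
apply: enorm_le; first by rewrite addr_ge0 ?enorm_ge0.
rewrite !(dotDl, dotDr) (dotC v u) sqrrD -!sqr_enorm.
have := dot_le_enorm u v; lra.
Qed.

Lemma enorm_dist u v w : enorm (u - w) <= enorm (u - v) + enorm (v - w).
Proof. by rewrite (le_trans _ (enormD _ _))// addrA subrK. Qed.

Lemma enorm_sum (I : finType) (P : pred I) (u : I -> 'rV[R]_d) :
  enorm (\sum_(i | P i) u i) <= \sum_(i | P i) enorm (u i).
Proof.
elim/big_rec2: _ => [|i x y _ le_xy]; first by rewrite enorm0.
by rewrite (le_trans (enormD _ _))// lerD2l.
Qed.

(** Young's inequality: the gap between the two sides is the squared norm of [t *: u - v] divided by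
    [t]. *)
Lemma sqr_enormD_le t u v : 0 < t ->
  enorm (u + v) ^+ 2 <= (1 + t) * enorm u ^+ 2 + (1 + t^-1) * enorm v ^+ 2.
Proof.
move=> t_gt0; rewrite !sqr_enorm !(dotDl, dotDr) (dotC v u).
have := dot_ge0 (t *: u - v).
rewrite !(dotBl, dotBr, dotZl, dotZr) (dotC v u) => h.
have : 0 <= t^-1 * (t * (t * dot u u) - t * dot u v - (t * dot u v - dot v v)).
  by rewrite mulr_ge0 ?invr_ge0 ?(ltW t_gt0)//; lra.
have -> : t^-1 * (t * (t * dot u u) - t * dot u v - (t * dot u v - dot v v)) =
  t * dot u u - 2 * dot u v + t^-1 * dot v v by field; rewrite gt_eqF.
lra.
Qed.

End EuclideanSpace.

(** * Means and variances over a finite set *)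

Section FiniteAverage.
Variables (R : realType) (A : finType).
Hypothesis A_gt0 : (0 < #|A|)%N.
Implicit Types (g h : A -> R).

Definition ravg g : R := #|A|%:R^-1 * \sum_a g a.

Let card_neq0 : #|A|%:R != 0 :> R.
Proof. by rewrite pnatr_eq0 -lt0n. Qed.

Lemma eq_ravg g h : g =1 h -> ravg g = ravg h.
Proof. by move=> gh; congr (_ * _); apply: eq_bigr => a _. Qed.

Lemma ravg_cst c : ravg (fun=> c) = c.
Proof. by rewrite /ravg sumr_const -(mulr_natl c) mulrA mulVf ?mul1r. Qed.

Lemma ravgD g h : ravg (fun a => g a + h a) = ravg g + ravg h.
Proof. by rewrite /ravg big_split mulrDr. Qed.

Lemma ravgZ c g : ravg (fun a => c * g a) = c * ravg g.
Proof. by rewrite /ravg -mulr_sumr mulrCA. Qed.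

Lemma ravgN g : ravg (fun a => - g a) = - ravg g.
Proof. by rewrite /ravg sumrN mulrN. Qed.

Lemma ravgB g h : ravg (fun a => g a - h a) = ravg g - ravg h.
Proof. by rewrite ravgD ravgN. Qed.

Lemma ravg_sum (I : finType) (P : pred I) (g : I -> A -> R) :
  ravg (fun a => \sum_(i | P i) g i a) = \sum_(i | P i) ravg (g i).
Proof. by rewrite /ravg exchange_big mulr_sumr. Qed.

Lemma ler_ravg g h : (forall a, g a <= h a) -> ravg g <= ravg h.
Proof. by move=> gh; rewrite ler_wpM2l ?invr_ge0// ler_sum. Qed.

Lemma ravg_ge0 g : (forall a, 0 <= g a) -> 0 <= ravg g.
Proof. by move=> g0; rewrite mulr_ge0 ?invr_ge0// sumr_ge0. Qed.

Lemma ravg_reindex (p : A -> A) g : injective p -> ravg (fun a => g (p a)) = ravg g.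
Proof. by move=> p_inj; rewrite /ravg [in RHS](reindex_inj p_inj). Qed.

Lemma sumr_ravg g : \sum_a g a = #|A|%:R * ravg g.
Proof. by rewrite /ravg mulrA mulfV ?mul1r. Qed.

Variable d : nat.
Implicit Types (p q : A -> 'rV[R]_d).

Definition vavg p : 'rV[R]_d := #|A|%:R^-1 *: \sum_a p a.

Lemma eq_vavg p q : p =1 q -> vavg p = vavg q.
Proof. by move=> pq; congr (_ *: _); apply: eq_bigr => a _. Qed.

Lemma vavg_cst c : vavg (fun=> c) = c.
Proof. by rewrite /vavg sumr_const -(scaler_nat _ c) scalerA mulVf ?scale1r. Qed.

Lemma vavgD p q : vavg (fun a => p a + q a) = vavg p + vavg q.
Proof. by rewrite /vavg big_split scalerDr. Qed.

Lemma vavgZ c p : vavg (fun a => c *: p a) = c *: vavg p.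
Proof. by rewrite /vavg -scaler_sumr !scalerA mulrC. Qed.

Lemma vavgN p : vavg (fun a => - p a) = - vavg p.
Proof. by rewrite /vavg sumrN scalerN. Qed.

Lemma vavgB p q : vavg (fun a => p a - q a) = vavg p - vavg q.
Proof. by rewrite vavgD vavgN. Qed.

Lemma vavg_sum (I : finType) (P : pred I) (p : I -> A -> 'rV[R]_d) :
  vavg (fun a => \sum_(i | P i) p i a) = \sum_(i | P i) vavg (p i).
Proof. by rewrite /vavg exchange_big scaler_sumr. Qed.

Lemma vavg_reindex (r : A -> A) p : injective r -> vavg (fun a => p (r a)) = vavg p.
Proof. by move=> r_inj; rewrite /vavg [in RHS](reindex_inj r_inj). Qed.

Lemma vavg_mulmxr p (M : 'M[R]_d) : vavg (fun a => p a *m M) = vavg p *m M.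
Proof. by rewrite /vavg -mulmx_suml scalemxAl. Qed.

Lemma sumr_vavg p : \sum_a p a = #|A|%:R *: vavg p.
Proof. by rewrite /vavg scalerA mulfV ?scale1r. Qed.

Lemma dot_vavgl p v : dot (vavg p) v = ravg (fun a => dot (p a) v).
Proof. by rewrite /vavg dotZl dot_suml. Qed.

Lemma enorm_vavg p : enorm (vavg p) <= ravg (fun a => enorm (p a)).
Proof. by rewrite /vavg enormZ ger0_norm ?invr_ge0// ler_wpM2l ?invr_ge0// enorm_sum. Qed.

Definition variance p : R := ravg (fun a => enorm (p a - vavg p) ^+ 2).

Lemma varianceE p :
  variance p = ravg (fun a => enorm (p a) ^+ 2) - enorm (vavg p) ^+ 2.
Proof.
rewrite /variance (@eq_ravg _ (fun a => enorm (p a) ^+ 2 +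
    ((- 2) * dot (p a) (vavg p) + enorm (vavg p) ^+ 2))) => [|a].
  by rewrite ravgD ravgD ravg_cst ravgZ -dot_vavgl sqr_enorm; lra.
by rewrite !sqr_enorm !(dotBl, dotBr) (dotC (vavg p) (p a)); lra.
Qed.

Lemma variance_ge0 p : 0 <= variance p.
Proof. by apply: ravg_ge0 => a; rewrite sqr_ge0. Qed.

Lemma variance_le p : variance p <= ravg (fun a => enorm (p a) ^+ 2).
Proof. by rewrite varianceE lerBlDr lerDl sqr_ge0. Qed.

Lemma sqr_enorm_vavg p : enorm (vavg p) ^+ 2 <= ravg (fun a => enorm (p a) ^+ 2).
Proof. by rewrite -subr_ge0 -varianceE variance_ge0. Qed.

Lemma sqr_enorm_sum p :
  enorm (\sum_a p a) ^+ 2 <= #|A|%:R * \sum_a enorm (p a) ^+ 2.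
Proof.
rewrite sumr_vavg sumr_ravg enormZ exprMn normr_nat expr2 -mulrA.
by rewrite !ler_wpM2l// sqr_enorm_vavg.
Qed.

Lemma varianceD_le t p q : 0 < t ->
  variance (fun a => p a + q a) <= (1 + t) * variance p + (1 + t^-1) * variance q.
Proof.
move=> t_gt0; rewrite /variance -!ravgZ -ravgD; apply: ler_ravg => a.
by rewrite vavgD opprD addrACA sqr_enormD_le.
Qed.

Lemma varianceZ c p : variance (fun a => c *: p a) = c ^+ 2 * variance p.
Proof.
rewrite /variance -ravgZ; apply: eq_ravg => a.
by rewrite vavgZ -scalerBr enormZ exprMn real_normK ?num_real.
Qed.

Lemma varianceDc c p : variance (fun a => c + p a) = variance p.
Proof.
apply: eq_ravg => a; rewrite vavgD vavg_cst.
by rewrite opprD addrACA subrr add0r.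
Qed.

Lemma eq_variance p q : p =1 q -> variance p = variance q.
Proof. by move=> pq; rewrite /variance (eq_vavg pq); apply: eq_ravg => a; rewrite pq. Qed.

End FiniteAverage.

Lemma vavg_exchange (R : realType) (A B : finType) (d : nat)
    (p : A -> B -> 'rV[R]_d) :
  vavg (fun a => vavg (fun b => p a b)) = vavg (fun b => vavg (fun a => p a b)).
Proof. by rewrite /vavg -!scaler_sumr !scalerA mulrC exchange_big. Qed.

(** * Linear permutation statistics *)

Section PermutationStatistics.
Variables (R : realType) (n d : nat).

Lemma card_perm_gt0 : (0 < #|'S_n|)%N.
Proof. by apply/card_gt0P; exists 1%g. Qed.

Lemma tperm_mul_inj (i j : 'I_n) : injective (fun s : 'S_n => (tperm i j * s)%g).
Proof. exact: mulgI. Qed.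

(** Composing with a transposition shows that the average does not depend on the position. Averaging
    over all positions then makes each single permutation run through every value once. *)
Lemma ravg_perm_at (g : 'I_n -> R) (i : 'I_n) :
  ravg (fun s : 'S_n => g (s i)) = ravg g.
Proof.
have n_gt0 : (0 < #|'I_n|)%N by rewrite card_ord (leq_ltn_trans _ (ltn_ord i)).
rewrite -[LHS](ravg_cst n_gt0).
rewrite (@eq_ravg _ _ _ (fun j => ravg (fun s : 'S_n => g (s j)))) => [|j]; last first.
  rewrite -(ravg_reindex (fun s : 'S_n => g (s i)) (@tperm_mul_inj i j)).
  by apply: eq_ravg => s; rewrite permM tpermL.
rewrite [LHS]/ravg -ravg_sum -ravgZ -[RHS](ravg_cst card_perm_gt0).
by apply: eq_ravg => s; rewrite /ravg [in RHS](reindex_inj (@perm_inj _ s)).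
Qed.

(* Exchanging [l] with the other positions off [j] averages [c (s l)] over all
   values but [s j], and that average is a multiple of [- c (s j)]. *)
Lemma ravg_perm_cross (b c : 'I_n -> 'rV[R]_d) (j l : 'I_n) :
  j != l -> \sum_k c k = 0 ->
  n.-1%:R * ravg (fun s : 'S_n => dot (b (s j)) (c (s l)))
    = - ravg (fun k => dot (b k) (c k)).
Proof.
move=> jl c0; transitivity
    (\sum_(l' | l' != j) ravg (fun s : 'S_n => dot (b (s j)) (c (s l')))).
  rewrite (eq_bigr (fun=> ravg (fun s : 'S_n => dot (b (s j)) (c (s l))))) => [|l' l'j].
    rewrite sumr_const mulr_natl; congr (_ *+ _).
    by rewrite cardC1 card_ord.
  rewrite -(ravg_reindex _ (@tperm_mul_inj l l')); apply: eq_ravg => s.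
  by rewrite !permM tpermR tpermD// eq_sym.
rewrite -ravg_sum -(ravg_perm_at _ j) -ravgN; apply: eq_ravg => s.
rewrite -dot_sumr -dotNr; congr (dot _ _); apply/eqP.
have : \sum_i c (s i) = 0 by rewrite -[RHS]c0 [RHS](reindex_inj (@perm_inj _ s)).
by rewrite (bigD1 j)//= addrC => /eqP; rewrite addr_eq0.
Qed.

(** After centering each [a j], the cross terms are negatively correlated. Multiplied by [n - 1],
    the variance becomes [n] times the averaged squares of the [b j] minus the average over [k] of
    the squared norm of [\sum_j b j k]. The latter is dropped. *)
Lemma variance_perm_sum (a : 'I_n -> 'I_n -> 'rV[R]_d) : (1 < n)%N ->
  variance (fun s : 'S_n => \sum_j a j (s j))
    <= n.-1%:R^-1 * \sum_j \sum_k enorm (a j k) ^+ 2.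
Proof.
move=> n_gt1; have In_gt0 : (0 < #|'I_n|)%N by rewrite card_ord ltnW.
pose b j k := a j k - vavg (a j).
have b0 j : \sum_k b j k = 0.
  by rewrite (sumr_vavg In_gt0) vavgB vavg_cst// subrr scaler0.
have vE : vavg (fun s : 'S_n => \sum_j a j (s j)) = \sum_j vavg (a j).
  rewrite vavg_sum; apply: eq_bigr => j _; apply/rowP => k.
  have := ravg_perm_at (fun l => a j l 0 k) j.
  by rewrite /ravg /vavg !mxE !summxE.
have varE : variance (fun s : 'S_n => \sum_j a j (s j))
    = \sum_j \sum_l ravg (fun s : 'S_n => dot (b j (s j)) (b l (s l))).
  rewrite /variance vE; under [RHS]eq_bigr do rewrite -ravg_sum.
  rewrite -ravg_sum; apply: eq_ravg => s; rewrite -sumrB sqr_enorm dot_suml.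
  by apply: eq_bigr => j _; rewrite dot_sumr.
have N_gt0 : 0 < n.-1%:R :> R by rewrite ltr0n -subn1 subn_gt0.
rewrite -(ler_pM2l N_gt0) mulVKf ?gt_eqF// varE mulr_sumr.
have nE : n%:R = n.-1%:R + 1 :> R by rewrite natr1 prednK// ltnW.
have jE j : n.-1%:R * \sum_l ravg (fun s : 'S_n => dot (b j (s j)) (b l (s l)))
  = n%:R * ravg (fun k => enorm (b j k) ^+ 2)
    - \sum_l ravg (fun k => dot (b j k) (b l k)).
  rewrite [in LHS](bigD1 j)//= [in RHS](bigD1 j)//= mulrDr mulr_sumr.
  have cross l : l != j -> n.-1%:R * ravg (fun s : 'S_n => dot (b j (s j)) (b l (s l)))
      = - ravg (fun k => dot (b j k) (b l k)).
    by move=> lj; apply: ravg_perm_cross; rewrite // eq_sym.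
  rewrite (eq_bigr _ cross).
  rewrite sumrN (ravg_perm_at (fun k => dot (b j k) (b j k))).
  by rewrite (eq_ravg (fun k => sqr_enorm (b j k))) nE; lra.
rewrite (eq_bigr _ (fun j _ => jE j)) sumrB lerBlDr.
apply: (@le_trans _ _ (\sum_j \sum_k enorm (a j k) ^+ 2)).
  apply: ler_sum => j _; rewrite (sumr_ravg In_gt0) card_ord ler_wpM2l//.
  exact: variance_le.
rewrite lerDl; under eq_bigr do rewrite -ravg_sum.
rewrite -ravg_sum; apply: ravg_ge0 => k; under eq_bigr do rewrite -dot_sumr.
by rewrite -dot_suml dot_ge0.
Qed.

End PermutationStatistics.

(** * Gradients and Hessians *)

Section GradientCalculus.
Variables (R : realType) (d : nat).
Implicit Types (f F : 'rV[R]_d -> R) (u v w x y : 'rV[R]_d).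

Lemma derive_gradient f x v : differentiable f x ->
  'D_v f x = dot (gradient f x) v.
Proof.
move=> fx; rewrite deriveE// {1}(row_sum_delta v) linear_sum /dot.
by apply: eq_bigr => j _; rewrite linearZ mxE deriveE// mulrC.
Qed.

Lemma gradient_average n (f : 'I_n -> 'rV[R]_d -> R) x :
  (forall i, differentiable (f i) x) ->
  gradient (average f) x = vavg (fun i => gradient (f i) x).
Proof.
move=> fx; apply/rowP => j; rewrite /vavg !mxE card_ord summxE.
have fD i : derivable (f i) x (delta_mx 0 j) by exact: diff_derivable.
have -> : average f = n%:R^-1 *: (\sum_(i < n) f i).
  by apply/funext => z; rewrite /average fct_sumE.
rewrite deriveZ ?derive_sum//; last exact: derivable_sum.
by congr (_ * _); apply: eq_bigr => i _; rewrite mxE.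
Qed.

Lemma cvg_difference_quotient f x v : differentiable f x ->
  (fun h : R => h^-1 * (f (x + h *: v) - f x)) h @[h --> 0^'+]
    --> dot (gradient f x) v.
Proof.
move=> fx; apply: cvg_dnbhs_at_right; rewrite -derive_gradient//.
have -> : (fun h : R => h^-1 * (f (x + h *: v) - f x))
    = (fun h : R => h^-1 *: ((f \o shift x) (h *: v) - f x)).
  by apply/funext => h /=; rewrite (addrC x).
exact: (@diff_derivable _ _ _ _ _ v fx).
Qed.

Lemma dot_gradient_le f x v a b : differentiable f x ->
  (forall t, 0 < t -> t <= 1 -> f (x + t *: v) - f x <= t * (a + b * t)) ->
  dot (gradient f x) v <= a.
Proof.
move=> fx fxv.
have ab : (fun t : R => a + b * t) t @[t --> 0^'+] --> a.
  rewrite -[X in _ --> X]addr0; apply: cvgD; first exact: cvg_cst.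
  rewrite -[X in _ --> X](mulr0 b); apply: cvgM; first exact: cvg_cst.
  exact/cvg_at_right_filter/cvg_id.
apply: (ler_cvg_to (@cvg_difference_quotient f x v fx) ab).
near=> t; have t0 : 0 < t by near: t; exact: nbhs_right_gt.
rewrite ler_pdivrMl// fxv//.
by near: t; apply: nbhs_right_le.
Unshelve. all: by end_near.
Qed.

Lemma strongly_convex_gradient mu f x y : differentiable f y ->
  strongly_convex mu f ->
  f y + dot (gradient f y) (x - y) + mu / 2 * enorm (x - y) ^+ 2 <= f x.
Proof.
move=> fy f_sc; suff : dot (gradient f y) (x - y)
    <= f x - f y - mu / 2 * enorm (x - y) ^+ 2 by lra.
(* The modulus [t * (1 - t)] splits into [t], which survives the limit, and [- t ^ 2], whose
   coefficient is the witness for [b]. *)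
apply: (@dot_gradient_le _ _ _ _ (mu / 2 * enorm (x - y) ^+ 2)) => // t t0 t1.
have -> : y + t *: (x - y) = t *: x + (1 - t) *: y.
  by rewrite scalerBr scalerBl scale1r addrCA addrC -addrA (addrC (- _)) addrA.
have := f_sc x y t; rewrite (ltW t0) t1 => /(_ isT); lra.
Qed.

(** Along the direction [- gradient f x] the difference quotients are nonnegative, so their limit,
    minus the squared gradient norm, is too. *)
Lemma gradient_minimizer f x : differentiable f x -> minimizer f x ->
  gradient f x = 0.
Proof.
move=> fx f_min; apply: enorm_eq0; apply/eqP.
rewrite -sqrf_eq0 eq_le sqr_ge0 andbT sqr_enorm -oppr_ge0 -dotNr.
apply: (cvgr_to_ge (@cvg_difference_quotient f x (- gradient f x) fx)).
near=> t; have t0 : 0 < t by near: t; exact: nbhs_right_gt.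
by rewrite mulr_ge0 ?invr_ge0 ?(ltW t0)// subr_ge0 f_min.
Unshelve. all: by end_near.
Qed.

(** Sum of the two first-order inequalities between [x] and [y]; the gradient at the minimizer
    vanishes. *)
Lemma strongly_convex_minimizer mu f x y : (forall z, differentiable f z) ->
  strongly_convex mu f -> minimizer f x ->
  mu * enorm (y - x) ^+ 2 <= dot (gradient f y) (y - x).
Proof.
move=> f_diff f_sc f_min.
have := strongly_convex_gradient x (f_diff y) f_sc.
have := strongly_convex_gradient y (f_diff x) f_sc.
by rewrite gradient_minimizer// dot0l -opprB dotNr enormN; lra.
Qed.

Lemma is_derive_line (W : normedModType R) (g : 'rV[R]_d -> W) x u (t : R) dg :
  is_derive (x + t *: u) u g dg -> is_derive t 1 (fun s : R => g (x + s *: u)) dg.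
Proof.
have E : (fun h : R => h^-1 *: (((fun s : R => g (x + s *: u)) \o shift t) (h *: 1)
      - g (x + t *: u)))
    = (fun h : R => h^-1 *: ((g \o shift (x + t *: u)) (h *: u) - g (x + t *: u))).
  by apply/funext => h /=; rewrite -[h *: 1]/(h * 1) mulr1 scalerDl addrCA.
by case=> gD gE; split; rewrite /derivable /derive E.
Qed.

Lemma is_derive_dot (g : R -> 'rV[R]_d) w t dg :
  is_derive t (1 : R) g dg -> is_derive t (1 : R) (fun s => dot (g s) w) (dot dg w).
Proof.
move=> [gD <-]; rewrite (derive_mx gD).
have -> : (fun s => dot (g s) w) = \sum_(j < d) (fun s => w 0 j *: g s 0 j).
  apply/funext => s; rewrite fct_sumE; apply: eq_bigr => j _.
  by rewrite mulrC.
have gjD j : derivable (fun s => g s 0 j) t 1 by exact: (derivable_mxP _ _ _).1.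
have <- : \sum_j w 0 j *: 'D_1 (fun s => g s 0 j) t
    = dot (\matrix_(i, j) 'D_1 (fun s => g s i j) t) w.
  by apply: eq_bigr => j _; rewrite mxE mulrC.
by apply: is_derive_sum => j; apply/is_deriveZ/derivableP.
Qed.

(** The size of [C] is irrelevant. Its existence bounds the set in [opnorm], without which the
    supremum would not dominate its elements. *)
Lemma enorm_mulmx_le (A : 'M[R]_d) : exists2 C : R, 0 <= C &
  forall v, enorm (v *m A) <= C * enorm v.
Proof.
exists (\sum_(i < d) enorm (row i A)); first by rewrite sumr_ge0// => i _; rewrite enorm_ge0.
move=> v; have -> : v *m A = \sum_i v 0 i *: row i A.
  by rewrite {1}(row_sum_delta v) mulmx_suml; apply: eq_bigr => i _; rewrite -scalemxAl rowE.
rewrite (le_trans (enorm_sum _ _))// mulr_suml ler_sum// => i _.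
rewrite enormZ mulrC ler_wpM2l ?enorm_ge0//.
rewrite -(@ler_pXn2r _ 2) ?nnegrE ?enorm_ge0// real_normK ?num_real//.
rewrite sqr_enorm /dot (bigD1 i)//= -expr2 lerDl sumr_ge0// => j _.
by rewrite -expr2 sqr_ge0.
Qed.

Lemma enorm_mulmx_opnorm (A : 'M[R]_d) v : enorm (v *m A) <= opnorm A * enorm v.
Proof.
have [v0|vN0] := eqVneq (enorm v) 0.
  by rewrite v0 mulr0 (enorm_eq0 v0) mul0mx enorm0.
have v_gt0 : 0 < enorm v by rewrite lt_def vN0 enorm_ge0.
have [C C_ge0 AC] := enorm_mulmx_le A.
rewrite -ler_pdivrMr//.
have -> : enorm (v *m A) / enorm v = enorm ((enorm v)^-1 *: v *m A).
  by rewrite -scalemxAl enormZ ger0_norm ?invr_ge0 ?enorm_ge0// mulrC.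
apply: ub_le_sup.
  exists C => _ [z /= z1 <-]; rewrite (le_trans (AC z))//.
  by rewrite -[leRHS]mulr1 ler_wpM2l.
exists ((enorm v)^-1 *: v) => //=.
by rewrite enormZ ger0_norm ?invr_ge0 ?enorm_ge0// mulVf.
Qed.

End GradientCalculus.

(** * Taylor remainder under a Hölder Hessian, and Jensen's inequality for powers *)

Section HolderRemainder.
Variables (R : realType) (d : nat).

(** Pairing the remainder [r] with itself reduces the claim to a scalar one on the segment. There
    the Hölder condition makes the derivative of [psi] nonnegative, and [psi 0 <= psi 1] reads
    [enorm r ^+ 2 <= C * enorm r]. *)
Lemma taylor_holder_hessian (nu rho : R) (f : 'rV[R]_d -> R) (x u : 'rV[R]_d) :
  0 < nu -> 0 <= rho -> (forall z, differentiable (gradient f) z) ->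
  holder_hessian nu rho f ->
  enorm (gradient f (x + u) - gradient f x - u *m hessian f x)
    <= rho / (1 + nu) * enorm u `^ (1 + nu).
Proof.
move=> nu_gt0 rho_ge0 gf_diff f_holder.
set r := (gradient f (x + u) - _ - _); set N := enorm u.
set C := rho / (1 + nu) * N `^ (1 + nu).
have nu1 : 0 < 1 + nu by rewrite addr_gt0.
have C_ge0 : 0 <= C by rewrite mulr_ge0 ?powR_ge0// divr_ge0// ltW.
suff rC : enorm r ^+ 2 <= C * enorm r.
  have [r0|rN0] := eqVneq (enorm r) 0; first by rewrite r0.
  have r_gt0 : 0 < enorm r by rewrite lt_def rN0 enorm_ge0.
  by rewrite -(ler_pM2r r_gt0) -expr2.
pose lin (t : R) := dot (gradient f (x + t *: u)) r - t * dot (u *m hessian f x) r.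
pose psi (t : R) := C * enorm r * t `^ (1 + nu) - lin t.
have lin_derive (t : R) : is_derive t (1 : R) lin
    (dot (u *m hessian f (x + t *: u)) r - dot (u *m hessian f x) r).
  apply: is_deriveB.
    apply: is_derive_dot; apply: is_derive_line.
    rewrite -deriveEjacobian//; apply/derivableP/diff_derivable/gf_diff.
  rewrite [X in is_derive _ _ _ X](_ : _ = dot (u *m hessian f x) r *: (1 : R)).
    rewrite (_ : (fun s => _) = dot (u *m hessian f x) r *: id); first exact: is_deriveZ.
    by apply/funext => s; rewrite mulrC.
  by rewrite -[RHS]/(_ * _) mulr1.
have psi_derive (t : R) : 0 < t -> is_derive t (1 : R) psi
    (C * enorm r * ((1 + nu) * t `^ nu)
     - (dot (u *m hessian f (x + t *: u)) r - dot (u *m hessian f x) r)).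
  move=> t_gt0; apply: is_deriveB; apply: is_deriveZ.
  by have := is_derive1_powR (1 + nu) t_gt0; rewrite (addrC 1) addrK.
have psi_cont (t : R) : 0 < t -> {for t, continuous psi}.
  move=> t_gt0; apply: differentiable_continuous; apply/derivable1_diffP.
  exact: (@ex_derive _ _ _ _ _ _ _ (psi_derive t t_gt0)).
have psi_diff (t : R) : t \in `]0, 1[ -> derivable psi t 1.
  rewrite in_itv/= => /andP[t_gt0 _].
  exact: (@ex_derive _ _ _ _ _ _ _ (psi_derive t t_gt0)).
have psi_ge0 (t : R) : t \in `]0, 1[ -> 0 <= psi^`()%classic t.
  rewrite in_itv/= => /andP[t_gt0 _].
  rewrite derive1E (@derive_val _ _ _ _ _ _ _ (psi_derive t t_gt0)) subr_ge0.
  rewrite -dotBl -mulmxBr (le_trans (dot_le_enorm _ _))//.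
  rewrite mulrAC ler_wpM2r ?enorm_ge0// (le_trans (enorm_mulmx_opnorm _ _))//.
  have -> : C * ((1 + nu) * t `^ nu) = rho * enorm (t *: u) `^ nu * N.
    rewrite /C enormZ gtr0_norm// powRM ?enorm_ge0 ?(ltW t_gt0)// -/N.
    rewrite -(@mulr_powRB1 _ N (1 + nu)) ?enorm_ge0// (addrC 1) addrK.
    by field; rewrite addrC gt_eqF.
  have xtu : x + t *: u - x = t *: u by rewrite addrAC subrr add0r.
  have := f_holder (x + t *: u) x; rewrite xtu => /ler_wpM2r; apply.
  exact: enorm_ge0.
(* The derivative of the power is available for positive [t] only, so right continuity at 0 is
   checked separately. *)
have psi_within : {within `[0, 1], continuous psi}.
  apply/continuous_within_itvP; first exact: ltr01.
  split.
  - by move=> t; rewrite in_itv/= => /andP[t_gt0 _]; exact: psi_cont.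
  - apply: cvgB.
      rewrite powR0 ?gt_eqF// mulr0 -[X in _ --> X](mulr0 (C * enorm r)).
      by apply: cvgM; [exact: cvg_cst|exact: powR_cvg0].
    apply: cvg_at_right_filter; apply: differentiable_continuous.
    by apply/derivable1_diffP; exact: (@ex_derive _ _ _ _ _ _ _ (lin_derive 0)).
  - by apply: cvg_at_left_filter; exact: psi_cont.
have psi01 : psi 0 <= psi 1.
  have := ger0_derive1_le_cc psi_diff psi_ge0 psi_within.
  by apply; rewrite ?in_itv/= ?lexx ?ler01.
move: psi01; rewrite /psi /lin powR0 ?gt_eqF// powR1 scale0r addr0 scale1r.
rewrite sqr_enorm {1}/r !dotBl; lra.
Qed.

(** A concave power lies below its tangent at 1. The bound [1 + s <= expR s] at [ln x - ln y] and at
    [- ln y], combined with weights [p] and [1 - p], leaves [y] alone because [ln y = p * ln x]. *)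
Lemma powR_le_tangent (p x : R) : 0 <= p -> p <= 1 -> 0 <= x ->
  x `^ p <= 1 + p * (x - 1).
Proof.
move=> p0 p1; rewrite le_eqVlt => /predU1P[<-|x_gt0].
  have [->|pN0] := eqVneq p 0; first by rewrite powRr0; lra.
  by rewrite powR0//; lra.
have y_gt0 := powR_gt0 p x_gt0; set y := x `^ p in y_gt0 *.
have lnE : ln y = p * ln x by rewrite ln_powR.
have h1 : x >= y * (1 + ln x - ln y).
  have := expR_ge1Dx (ln x - ln y); rewrite expRB !lnK ?posrE// => h.
  by rewrite mulrC -ler_pdivlMr// -addrA.
have h2 : 1 >= y * (1 - ln y).
  have := expR_ge1Dx (- ln y); rewrite expRN lnK ?posrE// => h.
  by rewrite mulrC -ler_pdivlMr// div1r.
have := ler_wpM2l p0 h1; have p1' : 0 <= 1 - p by lra.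
have := ler_wpM2l p1' h2; rewrite lnE; nra.
Qed.

(** Jensen for concave powers: rescale by [V] and average the tangent bound at 1. If [V] is 0, every
    [g a] vanishes. *)
Lemma ravg_powR_le (A : finType) (g : A -> R) (p V : R) : (0 < #|A|)%N ->
  0 < p -> p <= 1 -> (forall a, 0 <= g a) -> ravg g <= V ->
  ravg (fun a => g a `^ p) <= V `^ p.
Proof.
move=> A_gt0 p_gt0 p1 g_ge0 gV.
have : 0 <= V by rewrite (le_trans _ gV)// ravg_ge0.
rewrite le_eqVlt => /predU1P[V0|V_gt0].
  suff g0 a : g a = 0.
    rewrite (@eq_ravg _ _ _ (fun=> 0)) ?ravg_cst -?V0 ?powR_ge0// => a.
    by rewrite g0 powR0// gt_eqF.
  apply/eqP; rewrite eq_le g_ge0 andbT; move: gV; rewrite -V0 /ravg.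
  rewrite pmulr_rle0 ?invr_gt0 ?ltr0n// => /(le_trans _); apply.
  by rewrite (bigD1 a)//= lerDl sumr_ge0.
have -> : ravg (fun a => g a `^ p) = ravg (fun a => V `^ p * (V^-1 * g a) `^ p).
  apply: eq_ravg => a; rewrite -powRM ?mulr_ge0 ?invr_ge0 ?(ltW V_gt0)//.
  by rewrite mulrA divff ?gt_eqF// mul1r.
rewrite ravgZ -[leRHS]mulr1 ler_wpM2l ?powR_ge0//.
apply: (@le_trans _ _ (ravg (fun a => 1 + p * (V^-1 * g a - 1)))).
  apply: ler_ravg => a; apply: powR_le_tangent; rewrite ?(ltW p_gt0)//.
  by rewrite mulr_ge0 ?invr_ge0 ?(ltW V_gt0).
rewrite ravgD ravgZ ravgB ravgZ !ravg_cst// gerDl pmulr_rle0// subr_le0.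
by rewrite ler_pdivrMl// mulr1.
Qed.

End HolderRemainder.

(** * One epoch of random reshuffling *)

(** Turns a contraction over [k] steps into the rational factor [1 / (1 + k x)]. Each induction step
    loses [(k + 1) x ^ 2]. *)
Lemma bernoulli_inv (R : realType) (x : R) (k : nat) :
  0 <= x -> x <= 1 -> (1 - x) ^+ k * (1 + k%:R * x) <= 1.
Proof.
move=> x0 x1; elim: k => [|k IHk]; first by rewrite expr0 mul0r addr0 mul1r.
apply: le_trans IHk; rewrite exprSr -mulrA ler_wpM2l ?exprn_ge0 ?subr_ge0//.
rewrite -(natr1 k); have : 0 <= (k%:R + 1) * x ^+ 2 by rewrite mulr_ge0 ?sqr_ge0 ?addr_ge0.
lra.
Qed.

(** Used with [N = n - 1]: the factor [N] kept on the right cancels the [(n - 1)^-1] of the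
    permutation variance. *)
Lemma sum_sqr_lt (R : realType) (N : nat) :
  3 * \sum_(j < N.+1) (j%:R : R) ^+ 2 <= N%:R * N.+1%:R ^+ 2.
Proof.
have -> : 3 * \sum_(j < N.+1) (j%:R : R) ^+ 2 = N%:R * (N%:R + 1) * (N%:R + 1 / 2).
  elim: N => [|N IHN]; first by rewrite big_ord1/=; ring.
  by rewrite big_ord_recr/= mulrDr IHN -natr1; field.
rewrite -(natr1 N) expr2 !mulrA ler_wpM2l ?mulr_ge0//; lra.
Qed.

(* [g i] stands for the gradient of [f i], and later [H] for the Hessian of [F]. *)
Section Epoch.
Variables (R : realType) (d n : nat) (g : 'I_n -> 'rV[R]_d -> 'rV[R]_d).
Variables (L mu eta Gstar D : R) (xstar : 'rV[R]_d).

Definition epoch_prefix (s : 'S_n) (y : 'rV[R]_d) (k : nat) : 'rV[R]_d :=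
  foldl (fun x (i : 'I_n) => x - eta *: g (s i) x) y (take k (enum 'I_n)).

Let gF x := vavg (fun i => g i x).
Let G := Gstar + 2 * L * D.

Hypothesis n_gt1 : (1 < n)%N.
Hypothesis g_lip : forall i x y, enorm (g i x - g i y) <= L * enorm (x - y).
Hypotheses (mu_gt0 : 0 < mu) (mu_le_L : mu <= L).
Hypothesis gF_mono : forall x, mu * enorm (x - xstar) ^+ 2 <= dot (gF x) (x - xstar).
Hypothesis gF_star : gF xstar = 0.
Hypotheses (eta_gt0 : 0 < eta) (eta_le : n%:R * eta <= mu / (32 * L ^+ 2)).
Hypotheses (Gstar_ge0 : 0 <= Gstar) (D_ge : Gstar / (2 * L) <= D).
Hypothesis g_star : forall i, enorm (g i xstar) <= Gstar.

Let L_gt0 : 0 < L. Proof. exact: lt_le_trans mu_gt0 mu_le_L. Qed.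
Let In_gt0 : (0 < #|'I_n|)%N. Proof. by rewrite card_ord ltnW. Qed.
Let Sn_gt0 := card_perm_gt0 n.
Let n_ge2 : 2 <= n%:R :> R. Proof. by rewrite ler_nat. Qed.
Let n1_gt0 : 0 < n.-1%:R :> R. Proof. by rewrite ltr0n -subn1 subn_gt0. Qed.
Let n_predK : n.-1.+1 = n. Proof. by rewrite prednK// ltnW. Qed.
Let eta_ge0 := ltW eta_gt0.

Let Gstar_le : Gstar <= 2 * L * D.
Proof. by move: D_ge; rewrite ler_pdivrMr ?mulr_gt0// mulrC. Qed.

Let D_ge0 : 0 <= D.
Proof. by apply: le_trans D_ge; rewrite divr_ge0 ?mulr_ge0 ?(ltW L_gt0). Qed.

Let G_ge0 : 0 <= G.
Proof. by rewrite addr_ge0 ?mulr_ge0 ?(ltW L_gt0). Qed.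

Let etaLL : n%:R * eta * L ^+ 2 <= mu / 32.
Proof.
move: eta_le; rewrite ler_pdivlMr ?mulr_gt0 ?exprn_gt0// => h.
rewrite ler_pdivlMr//; lra.
Qed.

Let etaL : n%:R * eta * L <= 1 / 32.
Proof. by rewrite -(ler_pM2r L_gt0); move: etaLL mu_le_L; rewrite expr2; lra. Qed.

(** Since [G <= 4 * L * D], the drift over a whole epoch is at most [D / 8]. This keeps every
    iterate in the ball of radius [2 * D], on which [G] bounds the gradients. *)
Let etaG : n%:R * eta * G <= D / 8.
Proof.
have : n%:R * eta * G <= n%:R * eta * (4 * L * D).
  by rewrite ler_wpM2l ?mulr_ge0// /G; move: Gstar_le; lra.
have := ler_wpM2r D_ge0 etaL; lra.
Qed.

Let ler_sum_cst (F : 'I_n -> R) c : (forall l, F l <= c) -> \sum_l F l <= n%:R * c.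
Proof.
move=> Fc; apply: (@le_trans _ _ (\sum_(l < n) c)); first exact: ler_sum.
by rewrite sumr_const card_ord -[leLHS]mulr_natl.
Qed.

Lemma epoch_prefix0 s y : epoch_prefix s y 0 = y.
Proof. by rewrite /epoch_prefix take0. Qed.

Lemma epoch_prefixS s y (i : 'I_n) : epoch_prefix s y i.+1 =
  epoch_prefix s y i - eta *: g (s i) (epoch_prefix s y i).
Proof.
rewrite /epoch_prefix (take_nth i) ?size_enum_ord ?ltn_ord//.
by rewrite nth_ord_enum -cats1 foldl_cat.
Qed.

Lemma epoch_prefix_sum s y k : (k <= n)%N -> epoch_prefix s y k =
  y - eta *: \sum_(j < n) (if (j < k)%N then g (s j) (epoch_prefix s y j) else 0).
Proof.
elim: k => [_|k IHk kn].
  by rewrite epoch_prefix0 big1 ?scaler0 ?subr0.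
pose i := Ordinal kn; rewrite (epoch_prefixS s y i).
set p := epoch_prefix s y i; have pE : p = _ := IHk (ltnW kn).
rewrite {1}pE -addrA -opprD -scalerDr (bigD1 i)//= ltnn add0r [in RHS](bigD1 i)//= ltnSn.
congr (_ - _ *: _); rewrite addrC; congr (_ + _).
apply: eq_bigr => j ji; rewrite [in RHS]ltnS [in RHS]leq_eqVlt.
by have /negPf-> : (j : nat) != k by move: ji; rewrite -val_eqE.
Qed.

Lemma gF_lip x y : enorm (gF x - gF y) <= L * enorm (x - y).
Proof.
rewrite /gF -vavgB (le_trans (enorm_vavg _))//.
by rewrite -[leRHS](ravg_cst In_gt0); apply: ler_ravg => i.
Qed.

Lemma g_bound i x : enorm (x - xstar) <= 2 * D -> enorm (g i x) <= G.
Proof.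
move=> xD; have := enormD (g i x - g i xstar) (g i xstar); rewrite subrK => h.
have := g_lip i x xstar; have := g_star i; have := ler_wpM2l (ltW L_gt0) xD.
rewrite /G; lra.
Qed.

(** Strong monotonicity bounds the cross term and the Lipschitz property the quadratic one. It
    serves with [h = eta] for one mean step and with [h = n * eta] for a whole epoch. *)
Lemma gradient_step_le (h : R) u : 0 <= h ->
  enorm (u - h *: gF u - xstar) ^+ 2
    <= (1 - 2 * h * mu + h ^+ 2 * L ^+ 2) * enorm (u - xstar) ^+ 2.
Proof.
move=> h_ge0; rewrite addrAC.
have := gF_lip u xstar; rewrite gF_star subr0; have := gF_mono u.
move: (u - xstar) (gF u) => v w gM gL; rewrite sqr_enorm.
rewrite !(dotBl, dotBr, dotZl, dotZr) (dotC v (w)) -!sqr_enorm.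
have : enorm (w) ^+ 2 <= L ^+ 2 * enorm v ^+ 2.
  by rewrite -exprMn lerXn2r// nnegrE ?mulr_ge0 ?enorm_ge0// ltW.
move=> /(ler_wpM2l (sqr_ge0 h)) gL2; have := ler_wpM2l h_ge0 gM; lra.
Qed.

Variable y : 'rV[R]_d.
Hypothesis y_in : enorm (y - xstar) <= D.

Let X s k := epoch_prefix s y k.
Let m k := vavg (fun s : 'S_n => X s k).

Lemma prefix_ball x k : (k <= n)%N -> enorm (x - y) <= k%:R * (eta * G) ->
  enorm (x - xstar) <= 2 * D.
Proof.
move=> kn xy; rewrite (le_trans (enorm_dist _ y _))//.
have kn' : k%:R <= n%:R :> R by rewrite ler_nat.
have := ler_wpM2r (mulr_ge0 eta_ge0 G_ge0) kn'; have := etaG; have := y_in; have := D_ge0; lra.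
Qed.

(** The bound at [k] places the iterate in the ball where gradients are at most [G], which yields
    the bound at [k + 1]. *)
Lemma prefix_dist s k : (k <= n)%N -> enorm (X s k - y) <= k%:R * (eta * G).
Proof.
elim: k => [_|k IHk kn]; first by rewrite /X epoch_prefix0 subrr enorm0 mul0r.
pose i := Ordinal kn; have {}IHk := IHk (ltnW kn).
rewrite /X (epoch_prefixS s y i) -/(X s i) addrAC.
rewrite (le_trans (enormD _ _))// enormN enormZ ger0_norm// -natr1 mulrDl mul1r.
by rewrite lerD// ler_wpM2l// g_bound// (prefix_ball (ltnW kn)).
Qed.

Lemma X_ball s k : (k <= n)%N -> enorm (X s k - xstar) <= 2 * D.
Proof. by move=> kn; apply: (prefix_ball kn); exact: prefix_dist. Qed.

Lemma m_dist k : (k <= n)%N -> enorm (m k - y) <= k%:R * (eta * G).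
Proof.
move=> kn; rewrite -[y in m k - y](vavg_cst Sn_gt0) -vavgB.
rewrite (le_trans (enorm_vavg _))// -[leRHS](ravg_cst Sn_gt0).
by apply: ler_ravg => s; exact: prefix_dist.
Qed.

Lemma m_ball k : (k <= n)%N -> enorm (m k - xstar) <= 2 * D.
Proof. by move=> kn; apply: (prefix_ball kn); exact: m_dist. Qed.

(** For every permutation, the epoch is close to the full gradient step [u] of length [n * eta].
    With [a = n * eta * mu], that step gains [(63 / 64) * a * D], while the deviation costs at most
    [a * D / 8]. *)
Lemma epoch_stays_in_ball s : enorm (X s n - xstar) <= D.
Proof.
set u := y - (n%:R * eta) *: gF y.
have sumgF : \sum_j g (s j) y = n%:R *: gF y.
  have := sumr_vavg In_gt0 (fun k => g k y); rewrite card_ord -/(gF y) => <-.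
  by rewrite [RHS](reindex_inj (@perm_inj _ s)).
have uX : X s n - u = - (eta *: \sum_j (g (s j) (X s j) - g (s j) y)).
  rewrite sumrB sumgF /X epoch_prefix_sum// /u.
  under eq_bigr do rewrite ltn_ord.
  move: (gF y) (\sum_i _) => w v.
  by rewrite scalerBr scalerA (mulrC eta) !opprB addrC addrA subrK.
have uX_le : enorm (X s n - u) <= n%:R * eta * (L * (n%:R * eta * G)).
  rewrite uX enormN enormZ ger0_norm// -[leRHS]mulrA [leRHS]mulrCA ler_wpM2l//.
  rewrite (le_trans (enorm_sum _ _))//.
  apply: ler_sum_cst => j.
  rewrite (le_trans (g_lip _ _ _))// ler_wpM2l ?(ltW L_gt0)//.
  have jn := ltnW (ltn_ord j); rewrite (le_trans (prefix_dist s jn))// -mulrA.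
  by rewrite ler_wpM2r ?mulr_ge0// ler_nat.
(* The squared factor is at most [1 - 2 * a + a / 32], that is [1 - 2 * (63 / 64) * a], which
   completes to a square. *)
have u_le : enorm (u - xstar) <= (1 - n%:R * eta * mu * (63 / 64)) * D.
  set a := n%:R * eta * mu.
  have a_ge0 : 0 <= a by rewrite !mulr_ge0// ltW.
  have a_le : a <= 1 / 32.
    by have : a <= n%:R * eta * L; [rewrite ler_wpM2l ?mulr_ge0|have := etaL; lra].
  have q_ge0 : 0 <= 1 - a * (63 / 64) by lra.
  rewrite -(@ler_pXn2r _ 2)// ?nnegrE ?enorm_ge0 ?mulr_ge0//.
  rewrite (le_trans (gradient_step_le _ _)) ?mulr_ge0// [leRHS]exprMn.
  have aL : (n%:R * eta) ^+ 2 * L ^+ 2 <= a / 32.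
    by have := ler_wpM2l (mulr_ge0 (ler0n R n) eta_ge0) etaLL; rewrite /a; lra.
  have q_le : 1 - 2 * (n%:R * eta) * mu + (n%:R * eta) ^+ 2 * L ^+ 2
      <= (1 - a * (63 / 64)) ^+ 2.
    have -> : 2 * (n%:R * eta) * mu = 2 * a by rewrite /a; ring.
    by have := sqr_ge0 (a * (63 / 64)); move: aL; clearbody a; lra.
  apply: (le_trans (ler_wpM2r (sqr_ge0 _) q_le)).
  by rewrite ler_wpM2l ?sqr_ge0// lerXn2r ?nnegrE ?enorm_ge0.
rewrite (le_trans (enorm_dist _ u _))//.
have aL : n%:R * eta * (L * (n%:R * eta * G)) <= n%:R * eta * mu * (D / 8).
  have G4 : G <= 4 * L * D by rewrite /G; move: Gstar_le; lra.
  have ne_ge0 : 0 <= n%:R * eta by rewrite mulr_ge0.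
  rewrite -!mulrA [in leLHS]mulrA [in leRHS]mulrA; apply: ler_wpM2l => //.
  have : L * (n%:R * eta * G) <= L * (n%:R * eta * (4 * L * D)).
    by rewrite ler_wpM2l ?(ltW L_gt0)// ler_wpM2l.
  by have := ler_wpM2r D_ge0 etaLL; lra.
have : 0 <= n%:R * eta * mu * D by rewrite !mulr_ge0// ltW.
lra.
Qed.

(** * Stability of an epoch under a transposition *)

Lemma prefix_agree s (i j : 'I_n) k : (k <= i)%N -> (k <= j)%N ->
  X s k = X (tperm j i * s)%g k.
Proof.
elim: k => [_ _|k IHk ki kj]; first by rewrite /X !epoch_prefix0.
pose o := Ordinal (ltn_trans ki (ltn_ord i)).
have {}IHk := IHk (ltnW ki) (ltnW kj).
rewrite /X !(epoch_prefixS _ _ o) -!/(X _ _) -[X s o]/(X s k) IHk.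
by rewrite permM tpermD// -val_eqE/= gtn_eqF.
Qed.

(** Position [i] is not yet visited, so only the step at [j] uses different components; it
    contributes at most [2 * eta * G]. Every other step expands distances by at most [1 + eta * L],
    and the smallness of [n * eta * L] linearises the compounded growth. *)
Lemma prefix_stability s (i j : 'I_n) k : (k <= i)%N ->
  enorm (X s k - X (tperm j i * s)%g k)
    <= 2 * (eta * G) * (1 + 2 * (k%:R * (eta * L))).
Proof.
set s' := (tperm j i * s)%g.
elim: k => [_|k IHk ki].
  by rewrite /X !epoch_prefix0 subrr enorm0 mul0r mulr0 addr0 mulr1 !mulr_ge0.
have kn := ltn_trans ki (ltn_ord i); pose o := Ordinal kn.
have {}IHk := IHk (ltnW ki).
rewrite /X !(epoch_prefixS _ _ o) -!/(X _ _) -![X _ o]/(X _ k) -(natr1 k).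
have etaL_ge0 : 0 <= eta * L by rewrite mulr_ge0// ltW.
have kL_ge0 : 0 <= k%:R * (eta * L) by rewrite mulr_ge0.
have etaG_ge0 : 0 <= eta * G by rewrite mulr_ge0.
have [jk|jk] := eqVneq o j.
  rewrite -(prefix_agree s (ltnW ki)) -?jk// opprD addrACA subrr add0r opprK addrC.
  rewrite -scalerBr enormZ ger0_norm//.
  have gs i' : enorm (g i' (X s k)) <= G by apply: g_bound; apply: X_ball; exact: ltnW.
  apply: (@le_trans _ _ (eta * (2 * G))).
    rewrite ler_wpM2l// (le_trans (enormD _ _))// enormN.
    by have := gs (s o); have := gs (s' o); lra.
  by rewrite mulrCA ler_peMr ?mulr_ge0// lerDl mulr_ge0// mulr_ge0 ?addr_ge0.
have -> : s' o = s o.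
  by rewrite permM tpermD//; [rewrite eq_sym|rewrite -val_eqE/= gtn_eqF].
rewrite opprD addrACA -opprD -scalerBr (le_trans (enormD _ _))//.
rewrite enormN enormZ ger0_norm//.
have kL_le : k%:R * (eta * L) <= 1 / 32.
  have : k%:R * (eta * L) <= n%:R * (eta * L) by rewrite ler_wpM2r// ler_nat ltnW.
  have := etaL; lra.
have : eta * enorm (g (s o) (X s k) - g (s o) (X s' k))
    <= eta * L * enorm (X s k - X s' k) by rewrite -mulrA ler_wpM2l.
have h1 := ler_wpM2l etaL_ge0 IHk.
have : 0 <= eta * L * (eta * G) * (1 / 32 - k%:R * (eta * L)).
  by rewrite !mulr_ge0// ?subr_ge0// ltW.
have : 0 <= eta * L * (eta * G) by rewrite !mulr_ge0// ltW.
move: IHk h1; move: (enorm _) (enorm _) => e1 e2; lra.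
Qed.

Lemma stability_bias (i : 'I_n) :
  enorm (vavg (fun s : 'S_n => g (s i) (X s i)) - vavg (fun s : 'S_n => gF (X s i)))
    <= 17 / 8 * L * (eta * G).
Proof.
have etaG_ge0 : 0 <= eta * G by rewrite mulr_ge0.
(* [gF] averages over a fresh index [j]. Exchanging positions [i] and [j] lets both averages use the
   component [s i], so only the prefixes differ. Stability then gives
   [2 * (1 + 2 / 32) = 17 / 8]. *)
have gFE : vavg (fun s : 'S_n => gF (X s i))
    = vavg (fun j => vavg (fun s : 'S_n => g (s i) (X (tperm j i * s)%g i))).
  transitivity (vavg (fun j => vavg (fun s : 'S_n => g (s j) (X s i)))).
    rewrite [RHS]vavg_exchange; apply: eq_vavg => s; congr (_ *: _).
    by rewrite [LHS](reindex_inj (@perm_inj _ s)).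
  apply: eq_vavg => j.
  rewrite -(vavg_reindex _ (@tperm_mul_inj n j i)).
  by apply: eq_vavg => s; rewrite permM tpermL.
rewrite gFE -[X in X - _](vavg_cst In_gt0) -vavgB.
rewrite (le_trans (enorm_vavg _))// -[leRHS](ravg_cst In_gt0); apply: ler_ravg => j.
rewrite -vavgB (le_trans (enorm_vavg _))// -[leRHS](ravg_cst Sn_gt0).
apply: ler_ravg => s; rewrite (le_trans (g_lip _ _ _))//.
rewrite (mulrC _ L) -mulrA ler_wpM2l ?(ltW L_gt0)//.
rewrite (le_trans (prefix_stability s j (leqnn i)))//.
have : i%:R * (eta * L) <= 1 / 32.
  have : i%:R * (eta * L) <= n%:R * (eta * L).
    by rewrite ler_wpM2r ?mulr_ge0 ?(ltW L_gt0)// ler_nat ltnW.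
  have := etaL; lra.
move=> /(ler_wpM2l etaG_ge0); lra.
Qed.

(** * Variance of the iterates within an epoch *)

Let V k := variance (fun s : 'S_n => X s k).
(* [(32 / 31) ^+ 2] solves [v = 32 / 31 + 32 * (1 / 32) ^+ 2 * v], which makes the
   bound on the earlier variances reproduce itself. *)
Let Vb : R := (32 / 31) ^+ 2 * (n%:R * (eta * G) ^+ 2).

Let Vb_ge0 : 0 <= Vb.
Proof. by rewrite !mulr_ge0 ?sqr_ge0. Qed.

Lemma sum_ord_lt (k : nat) (F : nat -> R) : (k <= n)%N ->
  \sum_(j < n) (if (j < k)%N then F j else 0) = \sum_(j < k) F j.
Proof. by move=> kn; rewrite -big_mkcond -(big_ord_widen _ F kn). Qed.

(* [m] serves as the reference trajectory: along it the gradient sum is a linear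
   permutation statistic, up to the constant [b]. *)
Lemma prefix_variance_le (k : nat) (t : R) (b : 'rV[R]_d)
    (c : 'I_n -> 'I_n -> 'rV[R]_d) : (k <= n)%N -> 0 < t ->
  (forall s : 'S_n, \sum_(j < n) (if (j < k)%N then g (s j) (m j) else 0)
     = b + \sum_j c j (s j)) ->
  V k <= eta ^+ 2 * ((1 + t) * (n.-1%:R^-1 * \sum_j \sum_l enorm (c j l) ^+ 2)
                     + (1 + t^-1) * (n%:R * (L ^+ 2 * \sum_(j < k) V j))).
Proof.
move=> kn t_gt0 bc.
pose B (s : 'S_n) := \sum_(j < n)
  (if (j < k)%N then g (s j) (X s j) - g (s j) (m j) else 0).
have XE s : X s k = (y - eta *: b) + (- eta) *: (\sum_j c j (s j) + B s).
  rewrite /X epoch_prefix_sum// -!scaleNr -[RHS]addrA -scalerDr addrA -bc.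
  rewrite -big_split/=; congr (_ + _ *: _).
  by apply: eq_bigr => j _; case: ifP => _; rewrite ?addr0// addrC subrK.
rewrite /V (eq_variance XE) varianceDc// varianceZ sqrrN ler_wpM2l ?sqr_ge0//.
rewrite (le_trans (varianceD_le _ _ t_gt0))// lerD//.
  by rewrite ler_wpM2l ?variance_perm_sum// addr_ge0 ?ltW.
have t1 : 0 <= 1 + t^-1 by rewrite addr_ge0 ?invr_ge0 ?ltW.
rewrite ler_wpM2l// (le_trans (variance_le _ _))//.
apply: (@le_trans _ _ (ravg (fun s : 'S_n => n%:R * (L ^+ 2 *
    \sum_(j < n) (if (j < k)%N then enorm (X s j - m j) ^+ 2 else 0))))).
  apply: ler_ravg => s; rewrite (le_trans (sqr_enorm_sum In_gt0 _))// card_ord.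
  rewrite ler_wpM2l// mulr_sumr ler_sum// => j _.
  case: ifP => _; last by rewrite enorm0 expr0n mulr0.
  by rewrite -exprMn lerXn2r ?nnegrE ?mulr_ge0 ?enorm_ge0 ?(ltW L_gt0).
rewrite ravgZ ler_wpM2l// ravgZ ler_wpM2l ?sqr_ge0// ravg_sum.
rewrite -(sum_ord_lt V kn) ler_sum// => j _.
by case: ifP => _; rewrite ?ravg_cst.
Qed.

Lemma prefix_variance k : (k < n)%N -> V k <= Vb.
Proof.
elim/ltn_ind: k => k IHk kn.
pose c (j l : 'I_n) := if (j < k)%N then g l (m j) else 0.
have c_le : n.-1%:R^-1 * \sum_j \sum_l enorm (c j l) ^+ 2 <= n%:R * G ^+ 2.
  rewrite ler_pdivrMl//.
  apply: (@le_trans _ _ (\sum_(j < n) (if (j < k)%N then n%:R * G ^+ 2 else 0))).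
    apply: ler_sum => j _; rewrite /c; case: ifP => jk; last first.
      by rewrite big1// => l _; rewrite enorm0 expr0n.
    apply: ler_sum_cst => l.
    rewrite lerXn2r ?nnegrE ?enorm_ge0// g_bound// m_ball//.
    exact: ltnW (ltn_trans jk kn).
  (* As [k < n], at most [n - 1] positions are active, which absorbs the factor [(n - 1)^-1]. *)
  rewrite (sum_ord_lt (fun=> n%:R * G ^+ 2) (ltnW kn)) sumr_const card_ord.
  by rewrite -[leLHS]mulr_natl ler_wpM2r ?mulr_ge0 ?sqr_ge0// ler_nat -ltnS n_predK.
have VS : \sum_(j < k) V j <= n%:R * Vb.
  apply: (@le_trans _ _ (\sum_(j < k) Vb)).
    by apply: ler_sum => j _; apply: IHk => //; exact: ltn_trans kn.
  by rewrite sumr_const card_ord -[leLHS]mulr_natl ler_wpM2r// ler_nat ltnW.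
(* This weight produces the factors [32 / 31] and 32 of the equation that [Vb] solves. *)
have t_gt0 : 0 < 1 / 31 :> R by lra.
have := @prefix_variance_le k (1 / 31) 0 c (ltnW kn) t_gt0.
move=> /(_ (fun s => esym (add0r _))) h; rewrite (le_trans h)//.
have nL : 0 <= n%:R * eta * L by rewrite !mulr_ge0// ltW.
have nL2 : (n%:R * eta * L) ^+ 2 <= 1 / 1024.
  rewrite (_ : 1 / 1024 = (1 / 32) ^+ 2); last by field.
  by rewrite lerXn2r ?nnegrE//; lra.
have := ler_wpM2r Vb_ge0 nL2 => h2.
have h3 := ler_wpM2l (mulr_ge0 (sqr_ge0 eta) (mulr_ge0 (ler0n R n) (sqr_ge0 L))) VS.
have h4 := ler_wpM2l (sqr_ge0 eta) c_le.
have VbE : Vb = 1024 / 961 * (eta ^+ 2 * (n%:R * G ^+ 2)) by rewrite /Vb; field.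
have -> : (1 / 31 : R)^-1 = 31 by field.
move: h2 h3 h4 VbE; clearbody Vb; lra.
Qed.

Lemma epoch_variance :
  V n <= 3 * (L ^+ 2 * G ^+ 2 * n%:R ^+ 3 * eta ^+ 4).
Proof.
pose c (j l : 'I_n) := g l (m j) - g l y.
have eG : 0 <= eta * G by rewrite mulr_ge0.
have c_le : n.-1%:R^-1 * \sum_j \sum_l enorm (c j l) ^+ 2
    <= n%:R ^+ 3 / 3 * (L * (eta * G)) ^+ 2.
  rewrite ler_pdivrMl//.
  apply: (@le_trans _ _ (\sum_(j < n) n%:R * (j%:R ^+ 2 * (L * (eta * G)) ^+ 2))).
    apply: ler_sum => j _.
    apply: ler_sum_cst => l.
    rewrite -exprMn lerXn2r ?nnegrE ?enorm_ge0 ?mulr_ge0 ?(ltW L_gt0)//.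
    rewrite (le_trans (g_lip _ _ _))// mulrCA ler_wpM2l ?(ltW L_gt0)//.
    exact/m_dist/ltnW.
  rewrite -mulr_sumr -mulr_suml.
  have := sum_sqr_lt R n.-1; rewrite n_predK => h.
  have := ler_wpM2r (mulr_ge0 (ler0n R n) (sqr_ge0 (L * (eta * G)))) h.
  by move: (\sum_(j < n) _) => S; lra.
have VS : \sum_(j < n) V j <= n%:R * Vb.
  by apply: ler_sum_cst => j; exact: prefix_variance.
(* The weight 2 gives the factors 3 and [3 / 2]; the resulting constant
   [1 + (3 / 2) * (32 / 31) ^ 2] is below 3. *)
have := @prefix_variance_le n 2 (\sum_l g l y) c (leqnn n) (ltr0n R 2).
move=> h; rewrite (le_trans (h _)) => [//|s|].
  under eq_bigr do rewrite ltn_ord.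
  rewrite [X in X + _](reindex_inj (@perm_inj _ s)) -big_split/=.
  by apply: eq_bigr => j _; rewrite addrC subrK.
have h3 := ler_wpM2l (mulr_ge0 (sqr_ge0 eta) (mulr_ge0 (ler0n R n) (sqr_ge0 L))) VS.
have h4 := ler_wpM2l (sqr_ge0 eta) c_le.
have : 0 <= L ^+ 2 * G ^+ 2 * n%:R ^+ 3 * eta ^+ 4.
  by rewrite !mulr_ge0 ?exprn_ge0// ltW.
move: h3 h4; rewrite /Vb; move: (\sum_(j < n) V j) (n.-1%:R^-1 * _) => S1 S2.
lra.
Qed.

(** * Mean trajectory and contraction over one epoch *)

Variables (nu rho1 : R) (H : 'rV[R]_d -> 'M[R]_d).
Hypotheses (nu_gt0 : 0 < nu) (nu_le1 : nu <= 1) (rho1_ge0 : 0 <= rho1).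
Hypothesis gF_taylor : forall x u,
  enorm (gF (x + u) - gF x - u *m H x) <= rho1 * enorm u `^ (1 + nu).

Lemma curvature_bias (i : 'I_n) :
  enorm (vavg (fun s : 'S_n => gF (X s i)) - gF (m i))
    <= rho1 * Vb `^ ((1 + nu) / 2).
Proof.
have -> : vavg (fun s : 'S_n => gF (X s i)) - gF (m i)
    = vavg (fun s : 'S_n => gF (X s i) - gF (m i) - (X s i - m i) *m H (m i)).
  rewrite [RHS]vavgB vavg_mulmxr [X in _ - X *m _]vavgB vavg_cst// subrr mul0mx subr0.
  by rewrite [RHS]vavgB vavg_cst.
rewrite (le_trans (enorm_vavg _))//.
(* Written as a power of the squared deviation, the remainder has exponent [(1 + nu) / 2], at most
   1, so Jensen applies. *)
apply: (@le_trans _ _ (ravg (fun s : 'S_n =>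
    rho1 * (enorm (X s i - m i) ^+ 2) `^ ((1 + nu) / 2)))).
  apply: ler_ravg => s; have := gF_taylor (m i) (X s i - m i).
  rewrite [m i + _]addrC subrK => /le_trans; apply; rewrite ler_wpM2l//.
  rewrite -powR_mulrn ?enorm_ge0// -powRrM (_ : 2%:R * _ = 1 + nu)//.
  by rewrite mulrC divfK.
rewrite ravgZ ler_wpM2l// ravg_powR_le ?sqr_ge0//.
- by rewrite divr_gt0// addr_gt0.
- by have := nu_le1; lra.
- by move=> s; exact: sqr_ge0.
- exact: prefix_variance.
Qed.

Let delta := 17 / 8 * L * (eta * G) + rho1 * Vb `^ ((1 + nu) / 2).

Let delta_ge0 : 0 <= delta.
Proof. by rewrite addr_ge0 ?mulr_ge0 ?powR_ge0// ltW. Qed.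

(* Squared contraction factor of one step on [F]: [n >= 2] gives
   [eta * L ^+ 2 <= mu / 64]. *)
Let q : R := 1 - 127 / 64 * (eta * mu).

Let etamu_ge0 : 0 <= eta * mu. Proof. by rewrite mulr_ge0// ltW. Qed.

Let aval_le : n%:R * (eta * mu) <= 1 / 32.
Proof.
have : n%:R * (eta * mu) <= n%:R * (eta * L) by rewrite !ler_wpM2l.
have := etaL; lra.
Qed.

Let etamu_le : eta * mu <= 1 / 64.
Proof. by have := ler_wpM2r etamu_ge0 n_ge2; have := aval_le; lra. Qed.

Let q_ge0 : 0 <= q. Proof. by rewrite /q; have := etamu_le; lra. Qed.
Let q_le1 : q <= 1. Proof. by rewrite /q; have := etamu_ge0; lra. Qed.

Lemma mean_step (i : 'I_n) : enorm (m i.+1 - xstar)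
    <= Num.sqrt q * enorm (m i - xstar) + eta * delta.
Proof.
have mE : m i.+1 = m i - eta *: vavg (fun s : 'S_n => g (s i) (X s i)).
  rewrite /m (eq_vavg (fun s => epoch_prefixS s y i)) vavgB; congr (_ - _).
  exact: vavgZ.
set w := vavg _ in mE; have wF : enorm (w - gF (m i)) <= delta.
  rewrite (le_trans (enorm_dist _ (vavg (fun s : 'S_n => gF (X s i))) _))//.
  exact: lerD (stability_bias i) (curvature_bias i).
have -> : m i.+1 - xstar = (m i - eta *: gF (m i) - xstar) - eta *: (w - gF (m i)).
  move: mE wF (gF (m i)) => -> _ z; rewrite scalerBr opprB.
  by rewrite [RHS]addrAC addrA subrK.
rewrite (le_trans (enormD _ _))// enormN enormZ ger0_norm// lerD//; last first.
  by rewrite ler_wpM2l.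
rewrite -(@ler_pXn2r _ 2)// ?nnegrE ?enorm_ge0 ?mulr_ge0 ?sqrtr_ge0 ?enorm_ge0//.
rewrite [leRHS]exprMn (sqr_sqrtr q_ge0) (le_trans (gradient_step_le _ _))//.
rewrite ler_wpM2r ?sqr_ge0// /q.
have : eta ^+ 2 * L ^+ 2 <= eta * mu / 64.
  have := ler_wpM2l eta_ge0 etaLL.
  have := ler_wpM2r (mulr_ge0 (sqr_ge0 eta) (sqr_ge0 L)) n_ge2; lra.
lra.
Qed.

(** The biases are summed without contraction, using only [Num.sqrt q <= 1]. *)
Lemma mean_dist k : (k <= n)%N -> enorm (m k - xstar)
    <= Num.sqrt q ^+ k * enorm (y - xstar) + k%:R * (eta * delta).
Proof.
elim: k => [_|k IHk kn].
  rewrite /m (eq_vavg (fun s => epoch_prefix0 s y)) vavg_cst//.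
  by rewrite expr0 mul1r mul0r addr0.
rewrite (le_trans (mean_step (Ordinal kn)))// -[X in _ <= _ + X * _]natr1.
rewrite mulrDl mul1r addrA lerD2r.
have := ler_wpM2l (sqrtr_ge0 q) (IHk (ltnW kn)); move=> /le_trans; apply.
rewrite [leLHS]mulrDr exprS -mulrA lerD2l ler_piMl ?mulr_ge0//.
by rewrite -[leRHS]sqrtr1 ler_wsqrtr.
Qed.

Lemma epoch_mean : enorm (m n - xstar) ^+ 2 <=
  (1 - n%:R * (eta * mu) / 2) * enorm (y - xstar) ^+ 2
  + 3 / 4 * (n%:R * eta / mu) * delta ^+ 2.
Proof.
set a := n%:R * (eta * mu).
have a_gt0 : 0 < a by rewrite !mulr_gt0// ltr0n ltnW.
have a_le : a <= 1 / 32 := aval_le.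
(* This Young weight satisfies [1 + t <= (1 - a / 2) * (1 + 127 / 64 * a)] for [a <= 1 / 32], so
   Bernoulli leaves the factor [1 - a / 2]. The bias factor [1 + t^-1] stays below [(3 / 4) / a]. *)
have t_gt0 : 0 < 29 / 20 * a by lra.
set r0 := enorm (y - xstar); set e := n%:R * (eta * delta).
have e_ge0 : 0 <= e by rewrite !mulr_ge0.
have r0_ge0 : 0 <= r0 := enorm_ge0 _.
have qn_ge0 : 0 <= Num.sqrt q ^+ n by rewrite exprn_ge0// sqrtr_ge0.
have young (p z t : R) : 0 < t -> (p + z) ^+ 2 <= (1 + t) * p ^+ 2 + (1 + t^-1) * z ^+ 2.
  move=> t0; have : 0 <= t^-1 * (t * p - z) ^+ 2 by rewrite mulr_ge0 ?sqr_ge0 ?invr_ge0 ?ltW.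
  have -> : t^-1 * (t * p - z) ^+ 2 = t * p ^+ 2 - 2 * p * z + t^-1 * z ^+ 2.
    by field; rewrite gt_eqF.
  lra.
apply: (@le_trans _ _ ((Num.sqrt q ^+ n * r0 + e) ^+ 2)).
  rewrite lerXn2r ?nnegrE ?enorm_ge0 ?addr_ge0 ?mulr_ge0//.
  exact: mean_dist.
rewrite (le_trans (young _ _ _ t_gt0))// lerD//.
  rewrite exprMn mulrA ler_wpM2r ?sqr_ge0// exprAC sqr_sqrtr//.
  have x0 : 0 <= 127 / 64 * (eta * mu) by have := etamu_ge0; lra.
  have x1 : 127 / 64 * (eta * mu) <= 1 by have := etamu_le; lra.
  have := bernoulli_inv n x0 x1; rewrite -/q (mulrCA n%:R) -/a => qb.
  have q_n : 0 <= q ^+ n by rewrite exprn_ge0.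
  have : 1 + 29 / 20 * a <= (1 - a / 2) * (1 + 127 / 64 * a).
    have := ler_wpM2l (ltW a_gt0) a_le; lra.
  move=> /(ler_wpM2r q_n) /le_trans; apply.
  have a2 : 0 <= 1 - a / 2 by lra.
  by rewrite -[leLHS]mulrA ler_piMr// mulrC.
have -> : 3 / 4 * (n%:R * eta / mu) * delta ^+ 2 = 3 / 4 * a^-1 * e ^+ 2.
  rewrite /e /a; field.
  by rewrite !gt_eqF// ltr0n ltnW.
rewrite ler_wpM2r ?sqr_ge0//.
have -> : 1 + (29 / 20 * a)^-1 = (20 / 29 + a) * a^-1 by field; rewrite gt_eqF.
by rewrite ler_wpM2r ?invr_ge0 ?(ltW a_gt0)//; lra.
Qed.

Lemma epoch_contraction :
  ravg (fun s : 'S_n => enorm (X s n - xstar) ^+ 2)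
  <= (1 - n%:R * (eta * mu) / 2) * enorm (y - xstar) ^+ 2
     + (32 * L ^+ 2 * G ^+ 2 * n%:R * eta ^+ 3 / mu
        + 3 * L ^+ 2 * G ^+ 2 * n%:R ^+ 3 * eta ^+ 4
        + 6 / 7 * (n%:R * eta / mu) * rho1 ^+ 2
          * ((32 / 31) ^+ 2 * (n%:R * (eta * G) ^+ 2)) `^ (1 + nu)).
Proof.
have VE : V n = ravg (fun s : 'S_n => enorm (X s n - xstar) ^+ 2)
    - enorm (m n - xstar) ^+ 2.
  have -> : V n = variance (fun s : 'S_n => - xstar + X s n) by rewrite varianceDc.
  rewrite varianceE// vavgD vavg_cst// [- xstar + _]addrC; congr (_ - _).
  by apply: eq_ravg => s; rewrite addrC.
have -> : ravg (fun s : 'S_n => enorm (X s n - xstar) ^+ 2)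
    = enorm (m n - xstar) ^+ 2 + V n by rewrite VE addrC subrK.
have powE : (Vb `^ ((1 + nu) / 2)) ^+ 2 = Vb `^ (1 + nu).
  rewrite -powR_mulrn ?powR_ge0// -powRrM (_ : _ * 2%:R = 1 + nu)//.
  by rewrite divfK.
(* The split favours the curvature term, whose final constant is tight: it gets
   [(3 / 4) * (8 / 7) = 6 / 7], and the stability term gets [6 * (17 / 8) ^ 2], below 32. *)
have d2 : delta ^+ 2 <= 8 * (17 / 8 * L * (eta * G)) ^+ 2
    + 8 / 7 * (rho1 ^+ 2 * Vb `^ (1 + nu)).
  rewrite -powE -exprMn /delta; move: (17 / 8 * L * (eta * G)) (rho1 * _) => p z.
  have := sqr_ge0 (7 * p - z); lra.
have w_ge0 : 0 <= 3 / 4 * (n%:R * eta / mu).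
  by rewrite !mulr_ge0// invr_ge0 ltW.
have := ler_wpM2l w_ge0 d2; have := epoch_mean; have := epoch_variance; rewrite -/Vb.
have : 0 <= L ^+ 2 * G ^+ 2 * n%:R * eta ^+ 3 / mu.
  by rewrite !mulr_ge0 ?exprn_ge0 ?invr_ge0// ltW.
move: (Vb `^ (1 + nu)) (delta ^+ 2) (enorm (m n - xstar) ^+ 2) => W Q M.
lra.
Qed.

End Epoch.

(** * Expectation over the epochs *)

Section IndependentUniform.
Variables (R : realType) (disp : measure_display) (Omega : measurableType disp).
Variables (P : probability Omega R) (I A : finType) (X : I -> Omega -> A).
Hypothesis X_meas : forall i, measurable_element (X i).
Hypothesis X_unif : forall i, uniformly_distributed P (X i).
Hypothesis X_indep : mutually_independent P X.

(** Independence and uniformity make the joint law uniform on [{ffun I -> A}]; the integrand is a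
    finite combination of indicators of the events [E t]. *)
Lemma expectation_independent_uniform (h : {ffun I -> A} -> R) :
  (forall t, 0 <= h t) ->
  ('E_P[fun w : Omega => h [ffun i => X i w]] = (ravg h)%:E)%E.
Proof.
move=> h_ge0; pose E (t : {ffun I -> A}) := [set w | [ffun i => X i w] = t].
have EE t : E t = \bigcap_(i in [set` [set: I]%SET]) (X i @^-1` [set t i]).
  apply/seteqP; split=> w /=; first by move=> <- i _ /=; rewrite ffunE.
  move=> wt; apply/ffunP => i; rewrite ffunE; apply: (wt i).
  by rewrite /= inE.
have E_meas t : measurable (E t).
  rewrite EE; apply: fin_bigcap_measurable => // i _; exact: X_meas.
have PE t : P (E t) = (#|{ffun I -> A}|%:R^-1)%:E.
  rewrite EE X_indep (eq_bigr (fun=> (#|A|%:R^-1)%:E)) => [|i _]; last exact: X_unif.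
  by rewrite prodEFin prodr_const cardsT card_ffun natrX exprVn.
rewrite unlock.
have hE w : (h [ffun i => X i w])%:E = (\sum_t (h t)%:E * (\1_(E t) w)%:E)%E.
  rewrite (bigD1 [ffun i => X i w])//= big1 => [|t tw].
    by rewrite indicE mem_set// mule1 adde0.
  by rewrite indicE memNset ?mule0// => wt; rewrite wt eqxx in tw.
under eq_integral do rewrite hE.
have E_mfun t : measurable_fun setT (fun w => (\1_(E t) w : R)%:E).
  exact/measurable_EFinP/measurable_indic.
rewrite ge0_integral_sum//; last 2 first.
- move=> t; apply: emeasurable_funM; [exact: measurable_cst|exact: E_mfun].
- by move=> t w _; rewrite -EFinM lee_fin mulr_ge0.
rewrite (eq_bigr (fun t => (h t * #|{ffun I -> A}|%:R^-1)%:E)) => [|t _].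
  by rewrite sumEFin /ravg -mulr_suml mulrC.
rewrite ge0_integralZl_EFin// integral_indic// setIT EFinM; congr (_ * _)%E; exact: PE.
Qed.

End IndependentUniform.

(* The pairs [(t, s)] and [(t with t k replaced by s, t k)] correspond
   bijectively. *)
Lemma ravg_ffun_resample (R : realType) (I A : finType) (k : I)
    (h : {ffun I -> A} -> A -> R) : (0 < #|A|)%N ->
  (forall (t : {ffun I -> A}) a s,
    h [ffun i => if i == k then a else t i] s = h t s) ->
  ravg (fun t : {ffun I -> A} => h t (t k)) = ravg (fun t => ravg (h t)).
Proof.
move=> A_gt0 h_upd.
pose upd (p : {ffun I -> A} * A) := ([ffun i => if i == k then p.2 else p.1 i], p.1 k).
have updK : involutive upd.
  move=> [t s]; rewrite /upd /= ffunE eqxx; congr (_, _).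
  by apply/ffunP => i; rewrite !ffunE; case: eqP => [->|].
rewrite /ravg -mulr_sumr; congr (_ * _).
rewrite pair_big/= (reindex_inj (inv_inj updK))/=.
under [in RHS]eq_bigr do rewrite h_upd.
rewrite -(pair_big xpredT xpredT (fun t (s : A) => h t (t k)))/=.
rewrite mulr_sumr; apply: eq_bigr => t _.
by rewrite -[LHS](ravg_cst A_gt0).
Qed.

(** * Iterating the one-epoch estimate *)

Section Reshuffling.
Variables (R : realType) (d n : nat) (f : 'I_n -> 'rV[R]_d -> R) (eta : R).

Lemma rr_epochE (s : 'S_n) y :
  rr_epoch f eta s y = epoch_prefix (fun i => gradient (f i)) eta s y n.
Proof. by rewrite /epoch_prefix take_oversize// size_enum_ord. Qed.

Lemma eq_rr_iterate y0 (s s' : nat -> 'S_n) k : (forall j, (j < k)%N -> s j = s' j) ->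
  rr_iterate f eta y0 s k = rr_iterate f eta y0 s' k.
Proof.
elim: k => [//|k IHk] ss' /=; rewrite ss'// IHk// => j jk.
by rewrite ss'// ltnW.
Qed.

(** The identity is a filler at indices from [K] on, which the first [K] epochs never read. *)
Definition extend_ffun (K : nat) (t : {ffun 'I_K -> 'S_n}) (k : nat) : 'S_n :=
  if insub k is Some i then t i else 1%g.

Lemma extend_ffun_ord K (t : {ffun 'I_K -> 'S_n}) (i : 'I_K) : extend_ffun t i = t i.
Proof. by rewrite /extend_ffun valK. Qed.

Variables (xstar y0 : 'rV[R]_d) (D a B : R).
Hypothesis epoch_ball : forall s y, enorm (y - xstar) <= D ->
  enorm (rr_epoch f eta s y - xstar) <= D.
Hypothesis epoch_mean : forall y, enorm (y - xstar) <= D ->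
  ravg (fun s : 'S_n => enorm (rr_epoch f eta s y - xstar) ^+ 2)
    <= (1 - a) * enorm (y - xstar) ^+ 2 + B.
Hypotheses (y0_in : enorm (y0 - xstar) <= D) (a_gt0 : 0 < a) (a_le1 : a <= 1).
Hypothesis B_ge0 : 0 <= B.

(** [B / a] is the fixed point of [v |-> (1 - a) * v + B]. The ball invariant, valid for all
    permutations, licenses the one-epoch estimate at each iterate. *)
Lemma ravg_rr_iterate K k : (k <= K)%N ->
  ravg (fun t : {ffun 'I_K -> 'S_n} =>
    enorm (rr_iterate f eta y0 (extend_ffun t) k - xstar) ^+ 2)
  <= (1 - a) ^+ k * D ^+ 2 + B / a.
Proof.
have ffun_gt0 : (0 < #|{ffun 'I_K -> 'S_n}|)%N.
  by apply/card_gt0P; exists [ffun=> 1%g].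
elim: k => [_|k IHk kK] /=.
  rewrite ravg_cst// expr0 mul1r -[leLHS]addr0 lerD//; last by rewrite divr_ge0// ltW.
  by rewrite lerXn2r ?nnegrE ?enorm_ge0// (le_trans _ y0_in) ?enorm_ge0.
pose i := Ordinal kK.
pose h (t : {ffun 'I_K -> 'S_n}) (s : 'S_n) :=
  enorm (rr_epoch f eta s (rr_iterate f eta y0 (extend_ffun t) k) - xstar) ^+ 2.
have ball (t : {ffun 'I_K -> 'S_n}) j :
    enorm (rr_iterate f eta y0 (extend_ffun t) j - xstar) <= D.
  by elim: j => [//|j IHj]; exact: epoch_ball.
rewrite (@eq_ravg _ _ _ (fun t => h t (t i))) => [|t]; last first.
  by rewrite /h -(extend_ffun_ord t i).
(* The iterate before epoch [k] reads only coordinates below [k], so coordinate [k] can be averaged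
   on its own. *)
rewrite ravg_ffun_resample ?card_perm_gt0// => [|t b s]; last first.
  congr (enorm (rr_epoch f eta s _ - _) ^+ 2); apply: eq_rr_iterate => j jk.
  pose j' := Ordinal (ltn_trans jk kK).
  rewrite (extend_ffun_ord _ j') (extend_ffun_ord t j') ffunE.
  by rewrite -val_eqE/= ltn_eqF.
apply: (@le_trans _ _ (ravg (fun t : {ffun 'I_K -> 'S_n} => (1 - a) *
    enorm (rr_iterate f eta y0 (extend_ffun t) k - xstar) ^+ 2 + B))).
  by apply: ler_ravg => t; exact: epoch_mean.
rewrite ravgD ravgZ ravg_cst// exprS -mulrA.
have a1 : 0 <= 1 - a by rewrite subr_ge0.
have := ler_wpM2l a1 (IHk (ltnW kK)).
have : a * (B / a) = B by rewrite mulrCA divff ?mulr1// gt_eqF.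
lra.
Qed.

End Reshuffling.

(** * Final constants and the convergence bound *)

Lemma expR_ge_pow (R : realType) (a : R) (K : nat) : a <= 1 ->
  (1 - a) ^+ K <= expR (- (a * K%:R)).
Proof.
move=> a1; rewrite -mulNr expRM_natr lerXn2r ?nnegrE ?expR_ge0 ?subr_ge0//.
exact: expR_ge1Dx.
Qed.

(* The variance proxy exceeds [n eta^2 G^2] by the factor [(32/31)^2]; since
   [4^(1+nu) <= 16], it still fits under the constant [c_nu]. *)
Lemma holder_noise_le (R : realType) (n : nat) (nu rho eta mu G : R) :
  (0 < n)%N -> 0 < nu -> nu <= 1 -> 0 <= rho -> 0 < eta -> 0 < mu -> 0 <= G ->
  6 / 7 * (n%:R * eta / mu) * (rho / (1 + nu)) ^+ 2
    * ((32 / 31) ^+ 2 * (n%:R * (eta * G) ^+ 2)) `^ (1 + nu)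
    / (n%:R * (eta * mu) / 2)
  <= 32 * (2 `^ (- (1 + nu)) / (1 + nu)) ^+ 2 * rho ^+ 2 * G `^ (2 + 2 * nu)
     / mu ^+ 2 * n%:R `^ (1 + nu) * eta `^ (2 + 2 * nu).
Proof.
move=> n_gt0 nu_gt0 nu1 rho_ge0 eta_gt0 mu_gt0 G_ge0.
have eta_ge0 := ltW eta_gt0.
have nuE : 2 + 2 * nu = 2%:R * (1 + nu) by rewrite mulrDr mulr1.
rewrite nuE !(powRrM _ 2%:R) !powR_mulrn//.
rewrite (exprMn 2 eta G) (@powRM _ ((32 / 31) ^+ 2)) ?mulr_ge0 ?sqr_ge0//.
rewrite (@powRM _ n%:R) ?mulr_ge0 ?sqr_ge0// (@powRM _ (eta ^+ 2)) ?sqr_ge0// powRN.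
set k := ((32 / 31) ^+ 2) `^ _; set p := 2 `^ (1 + nu).
move: (n%:R `^ _) (powR_ge0 n%:R (1 + nu)) => N N_ge0.
move: ((eta ^+ 2) `^ _) (powR_ge0 (eta ^+ 2) (1 + nu)) => E E_ge0.
move: ((G ^+ 2) `^ _) (powR_ge0 (G ^+ 2) (1 + nu)) => W W_ge0.
have p_gt0 : 0 < p by rewrite powR_gt0.
(* The target [56 / 3] is 32 divided by [12 / 7]. The base [4 * (32 / 31) ^ 2] is below [43 / 10],
   whose square is below the target. *)
have kp : k * p ^+ 2 <= 56 / 3.
  have pE : p ^+ 2 = (2 ^+ 2) `^ (1 + nu).
    by rewrite -(powR_mulrn 2) ?powR_ge0// powRAC powR_mulrn.
  rewrite pE /k -powRM ?sqr_ge0//.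
  apply: (@le_trans _ _ ((43 / 10) `^ (1 + nu))).
    by apply: ge0_ler_powR; rewrite ?nnegrE ?mulr_ge0 ?sqr_ge0//; lra.
  apply: (@le_trans _ _ ((43 / 10) `^ 2%:R)); last by rewrite powR_mulrn//; lra.
  by apply: ler_powR; [lra|rewrite -(natr1 1); lra].
have nu1_gt0 : 0 < 1 + nu by rewrite addr_gt0.
have n_gt0' : 0 < n%:R :> R by rewrite ltr0n.
have Z_ge0 : 0 <= rho ^+ 2 / (1 + nu) ^+ 2 / mu ^+ 2 * N * E * W.
  by rewrite !mulr_ge0 ?invr_ge0 ?exprn_ge0// ltW.
set Z := (X in 0 <= X) in Z_ge0.
rewrite [leLHS](_ : _ = 12 / 7 * k * Z); last first.
  by rewrite /Z; field; rewrite !gt_eqF.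
rewrite [leRHS](_ : _ = 32 * (p ^+ 2)^-1 * Z); last first.
  by rewrite /Z; field; rewrite !gt_eqF.
rewrite ler_wpM2r// ler_pdivlMr ?exprn_gt0//; lra.
Qed.

Theorem theorem5p4 (R : realType) (d n : nat) (f : 'I_n -> 'rV[R]_d -> R)
    (L mu nu rho eta : R) (xstar y0 : 'rV[R]_d) (K : nat)
    (disp : measure_display) (Omega : measurableType disp)
    (P : probability Omega R) (sigma : nat -> Omega -> 'S_n) :
  let F := average f in
  let Gstar := \big[Num.max/0]_(i < n) enorm (gradient (f i) xstar) in
  let D := Num.max (enorm (y0 - xstar)) (Gstar / (2 * L)) in
  let G := Gstar + 2 * L * D in
  let T := (n * K)%N in
  let c := 2 `^ (- (1 + nu)) / (1 + nu) in
  (2 <= n)%N ->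
  (forall (i : 'I_n) (x : 'rV[R]_d), differentiable (f i) x) ->
  (forall i, lipschitz_gradient L (f i)) ->
  0 < mu -> mu <= L ->
  strongly_convex mu F ->
  unique (minimizer F) xstar ->
  0 < nu -> nu <= 1 -> 0 <= rho ->
  twice_differentiable F ->
  holder_hessian nu rho F ->
  0 < eta -> n%:R * eta <= mu / (32 * L ^+ 2) ->
  (1 <= K)%N ->
  (forall k, (k < K)%N -> measurable_element (sigma k)) ->
  (forall k, (k < K)%N -> uniformly_distributed P (sigma k)) ->
  mutually_independent P (fun k : 'I_K => sigma k) ->
  ('E_P[fun w : Omega =>
          (enorm (rr_iterate f eta y0 (fun k => sigma k w) K - xstar) ^+ 2)%R]
   <= (expR (- (mu * eta * T%:R / 2)) * D ^+ 2
       + 64 * L ^+ 2 * G ^+ 2 / mu ^+ 2 * eta ^+ 2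
       + 6 * L ^+ 2 * G ^+ 2 / mu * n%:R ^+ 2 * eta ^+ 3
       + 32 * c ^+ 2 * rho ^+ 2 * G `^ (2 + 2 * nu) / mu ^+ 2
         * n%:R `^ (1 + nu) * eta `^ (2 + 2 * nu))%R%:E)%E.
Proof.
move=> F Gstar D G T c n_gt1 f_diff f_lip mu_gt0 mu_le_L F_sc [xstar_min _]
  nu_gt0 nu_le1 rho_ge0 [F_diff gF_diff] F_holder eta_gt0 eta_le _
  sigma_meas sigma_unif sigma_indep.
have L_gt0 : 0 < L := lt_le_trans mu_gt0 mu_le_L.
have n_gt0 : (0 < n)%N := ltnW n_gt1.
have n_gt0' : 0 < n%:R :> R by rewrite ltr0n.
pose g i x := gradient (f i) x.
have gFE x : vavg (g^~ x) = gradient F x by rewrite gradient_average.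
have g_mono x : mu * enorm (x - xstar) ^+ 2 <= dot (vavg (g^~ x)) (x - xstar).
  by rewrite gFE; exact: strongly_convex_minimizer.
have g_star0 : vavg (g^~ xstar) = 0 by rewrite gFE gradient_minimizer.
have g_taylor x u : enorm (vavg (g^~ (x + u)) - vavg (g^~ x) - u *m hessian F x)
    <= rho / (1 + nu) * enorm u `^ (1 + nu).
  by rewrite !gFE; exact: taylor_holder_hessian.
have rho1_ge0 : 0 <= rho / (1 + nu) by rewrite divr_ge0// addr_ge0// ltW.
have Gstar_ge0 : 0 <= Gstar.
  apply: (@le_trans _ _ (enorm (gradient (f (Ordinal n_gt0)) xstar))).
    exact: enorm_ge0.
  exact: le_bigmax.
have D_ge : Gstar / (2 * L) <= D by rewrite le_max lexx orbT.
have D_ge0 : 0 <= D by rewrite (le_trans _ D_ge)// divr_ge0// mulr_ge0// ltW.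
have G_ge0 : 0 <= G by rewrite addr_ge0// !mulr_ge0// ltW.
have g_star i : enorm (g i xstar) <= Gstar by exact: le_bigmax.
have y0_in : enorm (y0 - xstar) <= D by rewrite le_max lexx.
pose a : R := n%:R * (eta * mu) / 2.
have a_gt0 : 0 < a by rewrite !mulr_gt0.
have a_le1 : a <= 1.
  have h1 : n%:R * eta * L ^+ 2 <= mu / 32.
    by move: eta_le; rewrite ler_pdivlMr ?mulr_gt0 ?exprn_gt0// => h; lra.
  have h2 : n%:R * (eta * mu) <= n%:R * eta * L by rewrite mulrA ler_wpM2l// !mulr_ge0 ?ltW.
  have h3 : n%:R * eta * L <= 1.
    by rewrite -(ler_pM2r L_gt0); move: h1 mu_le_L mu_gt0; rewrite expr2; lra.
  by rewrite /a; lra.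
pose N := 6 / 7 * (n%:R * eta / mu) * (rho / (1 + nu)) ^+ 2
  * ((32 / 31) ^+ 2 * (n%:R * (eta * G) ^+ 2)) `^ (1 + nu).
pose B := 32 * L ^+ 2 * G ^+ 2 * n%:R * eta ^+ 3 / mu
  + 3 * L ^+ 2 * G ^+ 2 * n%:R ^+ 3 * eta ^+ 4 + N.
have B_ge0 : 0 <= B.
  have [[eta_ge0 mu_ge0] L_ge0] := (ltW eta_gt0, ltW mu_gt0, ltW L_gt0).
  have nu1_ge0 : 0 <= 1 + nu by rewrite addr_ge0// ltW.
  by rewrite /B /N !addr_ge0// ?(mulr_ge0, exprn_ge0, invr_ge0, powR_ge0).
have epoch_ball (s : 'S_n) y : enorm (y - xstar) <= D ->
    enorm (rr_epoch f eta s y - xstar) <= D.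
  move=> y_in; rewrite rr_epochE.
  exact: (epoch_stays_in_ball (g := g) n_gt1 f_lip mu_gt0 mu_le_L g_mono g_star0
    eta_gt0 eta_le Gstar_ge0 D_ge g_star y_in).
have epoch_mean y : enorm (y - xstar) <= D ->
    ravg (fun s : 'S_n => enorm (rr_epoch f eta s y - xstar) ^+ 2)
    <= (1 - a) * enorm (y - xstar) ^+ 2 + B.
  move=> y_in; under eq_ravg do rewrite rr_epochE.
  exact: (epoch_contraction (g := g) n_gt1 f_lip mu_gt0 mu_le_L g_mono g_star0
    eta_gt0 eta_le Gstar_ge0 D_ge g_star y_in nu_gt0 nu_le1 rho1_ge0 g_taylor).
pose h (t : {ffun 'I_K -> 'S_n}) :=
  enorm (rr_iterate f eta y0 (extend_ffun t) K - xstar) ^+ 2.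
(* The error after [K] epochs depends on the first [K] permutations only, so it is a function of a
   uniform finite tuple. *)
have -> : (fun w : Omega =>
      enorm (rr_iterate f eta y0 (fun k => sigma k w) K - xstar) ^+ 2)
    = (fun w => h [ffun i : 'I_K => sigma i w]).
  apply/funext => w; rewrite /h; congr (enorm (_ - _) ^+ 2).
  apply: eq_rr_iterate => j jK.
  by rewrite (extend_ffun_ord _ (Ordinal jK)) ffunE.
rewrite expectation_independent_uniform//; last first.
- by move=> t; exact: sqr_ge0.
- by move=> i; exact: sigma_unif.
- by move=> i; exact: sigma_meas.
rewrite lee_fin.
have noise := holder_noise_le n_gt0 nu_gt0 nu_le1 rho_ge0 eta_gt0 mu_gt0 G_ge0.
rewrite (le_trans (ravg_rr_iterate epoch_ball epoch_mean y0_in a_gt0 a_le1 B_ge0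
  (leqnn K)))//.
(* Dividing by [a = n * eta * mu / 2] doubles 32 and 3 into the stated 64 and 6. *)
have -> : B / a = 64 * L ^+ 2 * G ^+ 2 / mu ^+ 2 * eta ^+ 2
    + 6 * L ^+ 2 * G ^+ 2 / mu * n%:R ^+ 2 * eta ^+ 3 + N / a.
  rewrite /B 2!mulrDl; congr (_ + _ + _); rewrite /a.
    by field; rewrite !gt_eqF.
  by field; rewrite !gt_eqF.
rewrite !addrA lerD// !lerD2r ler_wpM2r ?sqr_ge0//.
rewrite (le_trans (expR_ge_pow K a_le1))// ler_expR lerN2 /a /T natrM; lra.
Qed.
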